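(* Let $L>0$, let $\sigma>0$ with $\sigma\neq 1$, let $m=\frac{\sigma+1}{\sigma-1}$, and let $j\in\mathbb{Z}$. 1. If $\frac{j}{m}\notin\mathbb{Z}$ and $\frac{j+1}{m}\notin\mathbb{Z}$, there are exactly two simple interior transmission wavenumbers (and no others) in the strip $$\frac{2j\pi}{(\sigma+1)L}<\mathrm{Re}(k)<\frac{2(j+1)\pi}{(\sigma+1)L}.$$ (a) If $\lfloor\frac{j}{m}\rfloor\neq\lfloor\frac{j+1}{m}\rfloor$, both are real. (b) If $\lfloor\frac{j}{m}\rfloor=\lfloor\frac{j+1}{m}\rfloor$, they are complex conjugates of each other with nonzero imaginary parts. 2. If $\frac{j}{m}\in\mathbb{Z}$, there is a quadruple interior transmission wavenumber at $k=\frac{2j\pi}{(\sigma+1)L}$ and there are no others in the strip $$\frac{2(j-1)\pi}{(\sigma+1)L}<\mathrm{Re}(k)<\frac{2(j+1)\pi}{(\sigma+1)L}.$$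
   Context: The interior transmission wavenumbers for the constant index of refraction $\sigma$ on the interval $[-\frac L2,\frac L2]$ are the complex roots $k$ of the equation $$(\sigma-1)^{2}\sin^{2}\Big((\sigma+1)\frac{kL}{2}\Big)-(\sigma+1)^{2}\sin^{2}\Big((\sigma-1)\frac{kL}{2}\Big)=0,$$ and their multiplicity (simple, quadruple) is their multiplicity as zeros of the entire function of $k$ on the left-hand side. $\lfloor x\rfloor$ denotes the greatest integer less than or equal to $x$. *)

(* Defs.v *)
From Stdlib Require Import Reals.
From Coquelicot Require Import Coquelicot.

Definition is_integer (x : R) : Prop := exists n : Z, x = IZR n.

Definition Cexp (z : C) : C :=
  Cmult (RtoC (exp (Re z))) (cos (Im z), sin (Im z)).

Definition Csin (z : C) : C :=
  ((Cexp (Ci * z) - Cexp (- (Ci * z))) / (2 * Ci))%C.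

Fixpoint C_derive_n (f : C -> C) (n : nat) : C -> C :=
  match n with
  | O => f
  | S p => C_derive (C_derive_n f p)
  end.

(* Order of vanishing through the Taylor coefficients at [z]. [C_derive] is a
   total operator, so this is the multiplicity of the zero [z] only for [f]
   holomorphic near [z]; it is used for an entire [f] only. *)
Definition zero_of_multiplicity (f : C -> C) (z : C) (n : nat) : Prop :=
  (0 < n)%nat /\
  (forall i : nat, (i < n)%nat -> C_derive_n f i z = RtoC 0) /\
  C_derive_n f n z <> RtoC 0.

Definition transmission_fun (sigma L : R) (k : C) : C :=
  ((RtoC sigma - 1) ^ 2 * (Csin ((RtoC sigma + 1) * (k * L / 2))) ^ 2
   - (RtoC sigma + 1) ^ 2 * (Csin ((RtoC sigma - 1) * (k * L / 2))) ^ 2)%C.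

Definition transmission_wavenumber (sigma L : R) (k : C) : Prop :=
  transmission_fun sigma L k = RtoC 0.

Definition transmission_wavenumber_mult
    (sigma L : R) (n : nat) (k : C) : Prop :=
  zero_of_multiplicity (transmission_fun sigma L) k n.

(* Main.v *)
Require Import Defs.
From Stdlib Require Import Reals Lra Lia FunctionalExtensionality.
From Coquelicot Require Import Coquelicot.
Set Bullet Behavior "Strict Subproofs".
Open Scope R_scope.

(** Put [b = |sigma - 1| / (sigma + 1)], so that [0 < b < 1], and
    [z = (sigma + 1) * L / 2 * k = x + i y]. The equation becomes
    [b ^ 2 * sin z ^ 2 = sin (b * z) ^ 2], that is [b * sin z = +- sin (b * z)]
    (lemma [wavenumber_iff_root]), and the strips become [j * PI < x < (j + 1) * PI].
    Everything is decided by the position of the interval from [b * j] to [b * (j + 1)],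
    which is shorter than [1], among the integers.

    Real roots. The equation says that [b * x + asin (b * sin x)] or
    [b * x - asin (b * sin x)] is a multiple of [PI]. As [asin (b * sin x)] varies more
    slowly than [b * x], both functions increase strictly, from [b * j * PI] to
    [b * (j + 1) * PI]. Hence there are two real roots if an integer lies strictly
    inside the interval, and none otherwise ([two_real_roots], [real_root_window]).

    Non-real roots. These come in conjugate pairs, so let [y > 0]. With
    [A = b * cosh y / cosh (b * y)] and [B = b * sinh y / sinh (b * y)] the equation
    reads [A * sin x = +- sin (b * x)], [B * cos x = +- cos (b * x)]. Write
    [x = j * PI + PI / 2 + atan t]. The sum of the squares must be [1], which places the
    point on the curve [t ^ 2 * (B ^ 2 - 1) = 1 - A ^ 2]; on it there remains an equation
    between angles, [atan (t / T) - b * atan t = target] with [T = A / B]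
    ([root_iff_phase_gap]). The left side is odd in [t], bounded by [(1 - b) * PI / 2],
    and takes every value below that bound in absolute value on the curve
    ([curve_phase_gap_onto]), exactly once ([curve_root_unique]), because [A], [B] and
    [T] all increase with [y]. A target lies below the bound precisely when
    [n < b * j] and [b * (j + 1) < n + 1] for an integer [n]; so the roots are one
    conjugate pair if the closed interval contains no integer, and none otherwise.

    Multiplicities. If a zero of the function is also a zero of its derivative,
    then [sin z = 0], hence [x] is a multiple of [PI], which excludes the open strips
    ([wavenumber_simple]). At [x = j * PI] with [b * j] an integer the Taylor
    coefficients are explicit, and the fourth is the first that does not vanish
    ([wavenumber_quadruple]). *)

(** * Hyperbolic preliminaries *)

Lemma increasing_of_derive (f df : R -> R) (x y : R) :
  (forall z, x <= z <= y -> is_derive f z (df z)) ->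
  (forall z, x < z < y -> 0 < df z) -> x < y -> f x < f y.
Proof.
  intros Hd Hp Hxy.
  destruct (MVT_cor2 f df x y Hxy) as [c [Hc1 Hc2]].
  - intros z Hz; apply is_derive_Reals, Hd, Hz.
  - generalize (Rmult_lt_0_compat _ _ (Hp c Hc2) (proj2 (Rlt_0_minus x y) Hxy)). lra.
Qed.

Lemma cosh_pos y : 0 < cosh y.
Proof. unfold cosh. generalize (exp_pos y) (exp_pos (- y)). lra. Qed.

Lemma sinh_pos y : 0 < y -> 0 < sinh y.
Proof. intros Hy. rewrite <- sinh_0. now apply sinh_lt. Qed.

Lemma sinh_opp y : sinh (- y) = - sinh y.
Proof. unfold sinh. rewrite Ropp_involutive. lra. Qed.

Lemma cosh_opp y : cosh (- y) = cosh y.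
Proof. unfold cosh. rewrite Ropp_involutive. lra. Qed.

Lemma cosh2_sinh2 y : (cosh y) ^ 2 = 1 + (sinh y) ^ 2.
Proof.
  unfold cosh, sinh. assert (exp y * exp (- y) = 1).
  { rewrite <- exp_plus, Rplus_opp_r. apply exp_0. }
  nra.
Qed.

Lemma cosh_lt x y : 0 <= x -> x < y -> cosh x < cosh y.
Proof.
  intros Hx. apply (increasing_of_derive cosh sinh).
  - intros z _. apply is_derive_Reals, derivable_pt_lim_cosh.
  - intros z Hz. apply sinh_pos. lra.
Qed.

(** * Comparing hyperbolic functions at [y] and [b * y] *)

Section Ratios.

Variable b : R.
Hypothesis Hb : 0 < b < 1.

Lemma sinh_scale_lt y : 0 < y -> sinh (b * y) < b * sinh y.
Proof.
  intros Hy.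
  assert (H : b * sinh 0 - sinh (b * 0) < b * sinh y - sinh (b * y)).
  { apply (increasing_of_derive (fun y => b * sinh y - sinh (b * y))
             (fun y => b * cosh y - b * cosh (b * y))); [ | | exact Hy].
    - intros z _. auto_derive; trivial. ring.
    - intros z Hz. assert (cosh (b * z) < cosh z) by (apply cosh_lt; nra). nra. }
  rewrite Rmult_0_r, sinh_0 in H. lra.
Qed.

Lemma tanh_scale_gt y :
  0 < y -> b * sinh y * cosh (b * y) < sinh (b * y) * cosh y.
Proof.
  intros Hy.
  assert (H : sinh (b * 0) * cosh 0 - b * sinh 0 * cosh (b * 0)
            < sinh (b * y) * cosh y - b * sinh y * cosh (b * y)).
  { apply (increasing_of_derive
             (fun y => sinh (b * y) * cosh y - b * sinh y * cosh (b * y))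
             (fun y => (1 - b * b) * (sinh (b * y) * sinh y))); [ | | exact Hy].
    - intros z _. auto_derive; trivial. ring.
    - intros z Hz. assert (0 < sinh (b * z)) by (apply sinh_pos; nra).
      assert (0 < sinh z) by (apply sinh_pos; lra).
      apply Rmult_lt_0_compat; [nra | now apply Rmult_lt_0_compat]. }
  rewrite Rmult_0_r, sinh_0 in H. lra.
Qed.

Lemma tanh_scale_lt y :
  0 < y -> sinh (b * y) * cosh y < sinh y * cosh (b * y).
Proof.
  intros Hy.
  assert (H : 0 < sinh ((1 - b) * y)) by (apply sinh_pos; nra).
  unfold sinh, cosh in *.
  replace ((1 - b) * y) with (y + - (b * y)) in H by ring.
  replace (- (y + - (b * y))) with (- y + b * y) in H by ring.
  rewrite !exp_plus in H. nra.
Qed.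

(** Since [sin (x + i y)] has parts [sin x * cosh y] and [cos x * sinh y], these are
    the factors that turn the equation [b * sin z = +- sin (b * z)] into a relation
    between trigonometric functions of [x]:
    [ratio_cosh * sin x = +- sin (b * x)] and [ratio_sinh * cos x = +- cos (b * x)]. *)
Definition ratio_cosh (y : R) : R := b * cosh y / cosh (b * y).
Definition ratio_sinh (y : R) : R := b * sinh y / sinh (b * y).
Definition ratio_tanh (y : R) : R := ratio_cosh y / ratio_sinh y.

Lemma sinh_b_pos y : 0 < y -> 0 < sinh (b * y).
Proof. intros; apply sinh_pos; nra. Qed.

Lemma ratio_cosh_pos y : 0 < ratio_cosh y.
Proof.
  unfold ratio_cosh. apply Rdiv_lt_0_compat; [|apply cosh_pos].
  generalize (cosh_pos y); nra.
Qed.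

Lemma ratio_sinh_gt1 y : 0 < y -> 1 < ratio_sinh y.
Proof.
  intros Hy. unfold ratio_sinh. generalize (sinh_b_pos y Hy) (sinh_scale_lt y Hy).
  intros. apply Rmult_lt_reg_r with (sinh (b * y)); [lra|].
  unfold Rdiv. rewrite Rmult_assoc, Rinv_l; lra.
Qed.

Lemma ratio_tanh_eq y : 0 < y ->
  ratio_tanh y = sinh (b * y) * cosh y / (sinh y * cosh (b * y)).
Proof.
  intros Hy. unfold ratio_tanh, ratio_cosh, ratio_sinh.
  generalize (cosh_pos (b * y)) (sinh_b_pos y Hy) (sinh_pos y Hy).
  intros; field. repeat split; lra.
Qed.

Lemma ratio_tanh_bounds y : 0 < y -> b < ratio_tanh y < 1.
Proof.
  intros Hy. rewrite ratio_tanh_eq by assumption.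
  generalize (tanh_scale_gt y Hy) (tanh_scale_lt y Hy).
  assert (0 < sinh y * cosh (b * y))
    by (apply Rmult_lt_0_compat; [now apply sinh_pos | apply cosh_pos]).
  intros. split; apply Rmult_lt_reg_r with (sinh y * cosh (b * y)); auto;
  unfold Rdiv; rewrite Rmult_assoc, Rinv_l; lra.
Qed.

Lemma ratio_cosh_lt x y : 0 <= x -> x < y -> ratio_cosh x < ratio_cosh y.
Proof.
  intros Hx. apply (increasing_of_derive ratio_cosh
    (fun y => b * (sinh y * cosh (b * y) - b * cosh y * sinh (b * y))
              / (cosh (b * y)) ^ 2)).
  - intros z _. unfold ratio_cosh. generalize (cosh_pos (b * z)); intros.
    auto_derive; [lra|]. field. lra.
  - intros z Hz. generalize (cosh_pos (b * z)); intros.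
    apply Rdiv_lt_0_compat; [|nra]. apply Rmult_lt_0_compat; [lra|].
    assert (Hz0 : 0 < z) by lra.
    generalize (tanh_scale_lt z Hz0)
      (Rmult_lt_0_compat _ _ (sinh_b_pos z Hz0) (cosh_pos z)). nra.
Qed.

Lemma ratio_sinh_lt x y : 0 < x -> x < y -> ratio_sinh x < ratio_sinh y.
Proof.
  intros Hx. apply (increasing_of_derive ratio_sinh
    (fun y => b * (sinh (b * y) * cosh y - b * sinh y * cosh (b * y))
              / (sinh (b * y)) ^ 2)).
  - intros z Hz. unfold ratio_sinh. assert (0 < sinh (b * z)) by (apply sinh_b_pos; lra).
    auto_derive; [lra|]. field. lra.
  - intros z Hz. assert (Hz0 : 0 < z) by lra. generalize (sinh_b_pos z Hz0); intros.
    apply Rdiv_lt_0_compat; [|nra]. apply Rmult_lt_0_compat; [lra|].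
    generalize (tanh_scale_gt z Hz0). lra.
Qed.

(** After clearing denominators the derivative has the sign of
    [b * sinh (2 * y) - sinh (b * (2 * y))]. *)
Lemma ratio_tanh_lt x y : 0 < x -> x < y -> ratio_tanh x < ratio_tanh y.
Proof.
  intros Hx Hxy. rewrite !ratio_tanh_eq by lra. revert Hxy.
  apply (increasing_of_derive
    (fun y => sinh (b * y) * cosh y / (sinh y * cosh (b * y)))
    (fun y => (b * sinh (2 * y) - sinh (b * (2 * y))) / 2
              / (sinh y * cosh (b * y)) ^ 2)).
  - intros z Hz. assert (0 < sinh z) by (apply sinh_pos; lra).
    generalize (cosh_pos (b * z)); intros.
    assert (D : forall u, sinh (2 * u) = 2 * (sinh u * cosh u)).
    { intros u. unfold sinh, cosh. replace (2 * u) with (u + u) by ring.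
      rewrite Ropp_plus_distr, !exp_plus. field. }
    replace (b * (2 * z)) with (2 * (b * z)) by ring. rewrite !D.
    auto_derive; [nra|].
    generalize (cosh2_sinh2 z) (cosh2_sinh2 (b * z)). intros E1 E2.
    transitivity ((b * (cosh (b * z) ^ 2 - sinh (b * z) ^ 2) * (sinh z * cosh z)
       - (cosh z ^ 2 - sinh z ^ 2) * (sinh (b * z) * cosh (b * z)))
       / (sinh z * cosh (b * z)) ^ 2).
    + field. lra.
    + rewrite E1, E2. field. lra.
  - intros z Hz. assert (0 < sinh z) by (apply sinh_pos; lra).
    generalize (cosh_pos (b * z)); intros.
    assert (0 < sinh z * cosh (b * z)) by nra.
    apply Rdiv_lt_0_compat; [|nra].
    assert (Hz0 : 0 < 2 * z) by lra.
    generalize (sinh_scale_lt _ Hz0). lra.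
Qed.

(** Gives [ratio_sinh y -> 1] as [y -> 0], where the quotient itself is undefined. *)
Lemma ratio_sinh_le_cosh y : 0 < y -> ratio_sinh y <= cosh y.
Proof.
  intros Hy. generalize (ratio_tanh_bounds y Hy) (ratio_sinh_gt1 y Hy) (cosh_pos (b * y))
    (cosh_pos y); intros HT HB Hc Hc'.
  assert (H : b * ratio_sinh y < ratio_cosh y).
  { unfold ratio_tanh in HT. destruct HT as [HT _].
    apply Rmult_lt_compat_r with (r := ratio_sinh y) in HT; [|lra].
    unfold Rdiv in HT. rewrite Rmult_assoc, Rinv_l in HT; lra. }
  assert (H1 : ratio_cosh y <= b * cosh y).
  { unfold ratio_cosh. assert (1 < cosh (b * y)).
    { rewrite <- cosh_0. apply cosh_lt; nra. }
    apply Rle_div_l; [lra|].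
    assert (0 < b * cosh y) by (apply Rmult_lt_0_compat; lra). nra. }
  nra.
Qed.

End Ratios.

(** * Non-real roots: the phase equation *)

Lemma trig_shift_IZR (n : Z) :
  exists s, (s = 1 \/ s = -1) /\
    forall u, sin (IZR n * PI + u) = s * sin u /\ cos (IZR n * PI + u) = s * cos u.
Proof.
  assert (Hs : sin (IZR n * PI) = 0) by (apply sin_eq_0_1; now exists n).
  exists (cos (IZR n * PI)). split.
  - generalize (sin2_cos2 (IZR n * PI)). rewrite Hs. unfold Rsqr. intros H.
    assert (H' : (cos (IZR n * PI) - 1) * (cos (IZR n * PI) + 1) = 0) by lra.
    apply Rmult_integral in H'. lra.
  - intros u. rewrite sin_plus, cos_plus, Hs. lra.
Qed.

(** The equation [b * sin z = +- sin (b * z)] for [z = x + i y], written through real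
    and imaginary parts. *)
Definition scaled_sine_root (b x y : R) : Prop :=
  exists e, (e = 1 \/ e = -1) /\
    b * sin x * cosh y = e * (sin (b * x) * cosh (b * y)) /\
    b * cos x * sinh y = e * (cos (b * x) * sinh (b * y)).

Lemma scaled_sine_root_opp b x y :
  scaled_sine_root b x y -> scaled_sine_root b x (- y).
Proof.
  intros [e [He [H1 H2]]]. exists e. split; [exact He|].
  replace (b * - y) with (- (b * y)) by ring.
  rewrite !cosh_opp, !sinh_opp. split; lra.
Qed.

(** With [tan theta = t] and [tan phi = t / T], this is [phi - b * theta]. Where
    [(ratio_cosh * sin x, ratio_sinh * cos x)] is a unit vector, the requirement that it
    equal [+- (sin (b * x), cos (b * x))] prescribes this quantity modulo [PI]. *)
Definition phase_gap (b T t : R) : R := atan (t / T) - b * atan t.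

(** The derivative is a positive multiple of
    [(c - b) + s ^ 2 * c * (1 - b * c)]. The lemma serves twice: with [c = 1 / T] it
    makes [phase_gap] increasing, with [c = T] and [s] replaced by [1 / t] it bounds
    the gap by its limit at infinity. *)
Lemma atan_scale_lt b c s t : 0 < b < 1 -> b < c -> b * c < 1 -> s < t ->
  atan (c * s) - b * atan s < atan (c * t) - b * atan t.
Proof.
  intros Hb Hc Hbc. apply (increasing_of_derive (fun s => atan (c * s) - b * atan s)
    (fun s => ((c - b) + s ^ 2 * (c * (1 - b * c))) /
              ((1 + (c * s) ^ 2) * (1 + s ^ 2)))).
  - intros z _. auto_derive; trivial. field.
    split; generalize (pow2_ge_0 z) (pow2_ge_0 (c * z)); nra.
  - intros z _. generalize (pow2_ge_0 z) (pow2_ge_0 (c * z)); intros.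
    apply Rdiv_lt_0_compat; [|nra].
    assert (0 < c * (1 - b * c)) by (apply Rmult_lt_0_compat; lra). nra.
Qed.

Section Phase.

Variables (b T : R).
Hypothesis Hb : 0 < b < 1.
Hypothesis HT : b < T < 1.

Lemma phase_gap_lt s t : s < t -> phase_gap b T s < phase_gap b T t.
Proof.
  intros Hst. unfold phase_gap. unfold Rdiv. rewrite !(Rmult_comm _ (/ T)).
  apply atan_scale_lt; auto.
  - apply Rlt_trans with 1; [lra|]. rewrite <- Rinv_1.
    apply Rinv_lt_contravar; lra.
  - apply Rmult_lt_reg_r with T; [lra|]. rewrite Rmult_assoc, Rinv_l; lra.
Qed.

Lemma phase_gap_0 : phase_gap b T 0 = 0.
Proof. unfold phase_gap, Rdiv. rewrite Rmult_0_l, atan_0. ring. Qed.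

Lemma phase_gap_opp t : phase_gap b T (- t) = - phase_gap b T t.
Proof.
  unfold phase_gap. replace (- t / T) with (- (t / T)) by (unfold Rdiv; ring).
  rewrite !atan_opp. ring.
Qed.

Lemma phase_gap_pos t : 0 < t -> 0 < phase_gap b T t.
Proof. intros Ht. rewrite <- phase_gap_0. now apply phase_gap_lt. Qed.

Lemma phase_gap_ub t : 0 < t -> phase_gap b T t < (1 - b) * PI / 2.
Proof.
  intros Ht.
  assert (Hi : 0 < / t) by now apply Rinv_0_lt_compat.
  assert (H : atan (T * 0) - b * atan 0 < atan (T * / t) - b * atan (/ t))
    by (apply atan_scale_lt; nra).
  rewrite Rmult_0_r, atan_0 in H.
  assert (H1 : atan (/ t) = PI / 2 - atan t) by (apply atan_inv; lra).
  assert (H2 : atan (T * / t) = PI / 2 - atan (t / T)).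
  { rewrite <- (atan_inv (t / T)).
    - f_equal. field. lra.
    - apply Rdiv_lt_0_compat; lra. }
  rewrite H1, H2 in H. unfold phase_gap. lra.
Qed.

Lemma phase_gap_bound t : Rabs (phase_gap b T t) < (1 - b) * PI / 2.
Proof.
  destruct (Rtotal_order t 0) as [H | [-> | H]].
  - rewrite <- (Ropp_involutive t), phase_gap_opp, Rabs_Ropp, Rabs_pos_eq.
    + apply phase_gap_ub. lra.
    + left. apply phase_gap_pos. lra.
  - rewrite phase_gap_0, Rabs_R0. generalize PI_RGT_0. nra.
  - rewrite Rabs_pos_eq; [now apply phase_gap_ub | left; now apply phase_gap_pos].
Qed.

End Phase.

Lemma cos_atan_pos t : 0 < cos (atan t).
Proof. apply cos_gt_0; generalize (atan_bound t); lra. Qed.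

Lemma sin_atan_cos t : sin (atan t) = t * cos (atan t).
Proof.
  rewrite <- (tan_atan t) at 2. unfold tan. field.
  generalize (cos_atan_pos t); lra.
Qed.

Lemma cos_atan_sqr t : (cos (atan t)) ^ 2 * (1 + t ^ 2) = 1.
Proof.
  generalize (sin2_cos2 (atan t)). rewrite sin_atan_cos. unfold Rsqr. lra.
Qed.

Section Strip.

Variables (b : R) (j : Z).
Hypothesis Hb : 0 < b < 1.

Let A := ratio_cosh b.
Let B := ratio_sinh b.
Let T := ratio_tanh b.

(** Parametrizes the strip by the tangent of the offset from its middle line; the
    sign of [t] then tells the two halves of the strip apart, and reflecting in the
    middle line is [t -> - t]. *)
Definition strip_point (t : R) : R := IZR j * PI + (PI / 2 + atan t).

Definition phase_target (n : Z) : R := (b * (IZR j + 1 / 2) - 1 / 2 - IZR n) * PI.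

(** For fixed [x] and [y > 0] the equation says that the vectors [(A sin x, B cos x)] and
    [+- (sin (b x), cos (b x))] coincide. Their lengths agree exactly when
    [t ^ 2 * (B ^ 2 - 1) = 1 - A ^ 2], and then their directions agree modulo [PI]
    exactly when the phase gap is one of the targets. *)
Lemma root_iff_phase_gap y t : 0 < y ->
  (scaled_sine_root b (strip_point t) y <->
   t ^ 2 * (B y ^ 2 - 1) = 1 - A y ^ 2 /\
   exists n, phase_gap b (T y) t = phase_target n).
Proof.
  intros Hy.
  assert (HA : 0 < A y) by now apply ratio_cosh_pos.
  assert (HB : 1 < B y) by now apply ratio_sinh_gt1.
  assert (HTy : t / T y = t * B y / A y).
  { unfold T, ratio_tanh. fold A B. field. lra. }
  assert (Hch : 0 < cosh (b * y)) by apply cosh_pos.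
  assert (Hsh : 0 < sinh (b * y)) by now apply sinh_b_pos.
  assert (EA : A y * cosh (b * y) = b * cosh y).
  { unfold A, ratio_cosh. field. lra. }
  assert (EB : B y * sinh (b * y) = b * sinh y).
  { unfold B, ratio_sinh. field. lra. }
  destruct (trig_shift_IZR j) as [s [Hs Hsh_j]].
  assert (Hss : s * s = 1) by (destruct Hs as [-> | ->]; ring).
  set (c := cos (atan t)).
  assert (Hc : 0 < c) by apply cos_atan_pos.
  assert (Hc2 : c ^ 2 * (1 + t ^ 2) = 1) by apply cos_atan_sqr.
  set (x := strip_point t).
  assert (Hsin : sin x = s * c).
  { unfold x, strip_point. destruct (Hsh_j (PI / 2 + atan t)) as [-> _].
    rewrite sin_plus, sin_PI2, cos_PI2. unfold c. ring. }
  assert (Hcos : cos x = - s * (t * c)).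
  { unfold x, strip_point. destruct (Hsh_j (PI / 2 + atan t)) as [_ ->].
    rewrite cos_plus, sin_PI2, cos_PI2, sin_atan_cos. unfold c. ring. }
  set (h := atan (t / T y)).
  (* On the curve, [h] is the angle of the unit vector
     [(A cos, B sin)] obtained by rescaling that of [atan t]. *)
  assert (Hh : t ^ 2 * (B y ^ 2 - 1) = 1 - A y ^ 2 ->
               cos h = A y * c /\ sin h = t * B y * c).
  { intros Hcurve.
    assert (E : cos h = A y * c).
    { apply Rsqr_inj.
      - left. apply cos_atan_pos.
      - left. now apply Rmult_lt_0_compat.
      - generalize (cos_atan_sqr (t / T y)). fold h. rewrite HTy. intros H.
        assert (H' : cos h ^ 2 * (A y ^ 2 + t ^ 2 * B y ^ 2) = A y ^ 2).
        { transitivity (cos h ^ 2 * (1 + (t * B y / A y) ^ 2) * A y ^ 2).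
          - field. lra.
          - rewrite H. ring. }
        replace (A y ^ 2 + t ^ 2 * B y ^ 2) with (1 + t ^ 2) in H' by lra.
        unfold Rsqr. transitivity (cos h ^ 2 * (1 + t ^ 2) * c ^ 2).
        + transitivity (cos h ^ 2 * (c ^ 2 * (1 + t ^ 2))); [rewrite Hc2|]; ring.
        + rewrite H'. ring. }
    split; [exact E|]. unfold h at 1. rewrite sin_atan_cos. fold h.
    rewrite E, HTy. field. lra. }
  split.
  - intros [e [He [H1 H2]]].
    assert (Hee : e * e = 1) by (destruct He as [-> | ->]; ring).
    rewrite Hsin in H1. rewrite Hcos in H2.
    assert (H1' : s * c * A y = e * sin (b * x)).
    { apply Rmult_eq_reg_r with (cosh (b * y)); [|lra].
      transitivity (s * c * (A y * cosh (b * y))); [ring|]. rewrite EA. lra. }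
    assert (H2' : - s * (t * c) * B y = e * cos (b * x)).
    { apply Rmult_eq_reg_r with (sinh (b * y)); [|lra].
      transitivity (- s * (t * c) * (B y * sinh (b * y))); [ring|]. rewrite EB. lra. }
    assert (Hcurve : t ^ 2 * (B y ^ 2 - 1) = 1 - A y ^ 2).
    { generalize (sin2_cos2 (b * x)). unfold Rsqr. intros Hp.
      assert (E : c ^ 2 * (A y ^ 2 + t ^ 2 * B y ^ 2) = 1).
      { transitivity ((s * s) * (c ^ 2 * (A y ^ 2 + t ^ 2 * B y ^ 2)));
          [rewrite Hss; ring|].
        transitivity ((s * c * A y) ^ 2 + (- s * (t * c) * B y) ^ 2); [ring|].
        rewrite H1', H2'.
        transitivity ((e * e) * (sin (b * x) * sin (b * x) + cos (b * x) * cos (b * x)));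
          [ring|]. rewrite Hp, Hee. ring. }
      assert (A y ^ 2 + t ^ 2 * B y ^ 2 = 1 + t ^ 2).
      { apply Rmult_eq_reg_l with (c ^ 2); [lra|]. apply pow_nonzero. lra. }
      lra. }
    split; [exact Hcurve|].
    destruct (Hh Hcurve) as [Ec Es].
    assert (H0 : cos (b * x - h) = 0).
    { rewrite cos_minus, Ec, Es.
      transitivity ((e * e) * (cos (b * x) * (A y * c) + sin (b * x) * (t * B y * c)));
        [rewrite Hee; ring|].
      transitivity (e * ((e * cos (b * x)) * (A y * c) + (e * sin (b * x)) * (t * B y * c)));
        [ring|]. rewrite <- H1', <- H2'. ring. }
    apply cos_eq_0_0 in H0. destruct H0 as [n Hn]. exists n.
    unfold phase_gap. fold h. unfold x, strip_point in Hn. unfold phase_target. lra.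
  - intros [Hcurve [n Hn]].
    destruct (Hh Hcurve) as [Ec Es].
    destruct (trig_shift_IZR n) as [s' [Hs' Hsh_n]].
    assert (Hss' : s' * s' = 1) by (destruct Hs' as [-> | ->]; ring).
    assert (Hbx : b * x = IZR n * PI + (PI / 2 + h)).
    { unfold phase_gap in Hn. fold h in Hn. unfold phase_target in Hn.
      unfold x, strip_point. lra. }
    destruct (Hsh_n (PI / 2 + h)) as [E1 E2]. rewrite <- Hbx in E1, E2.
    rewrite sin_plus, sin_PI2, cos_PI2 in E1. rewrite cos_plus, sin_PI2, cos_PI2 in E2.
    exists (s * s'). split.
    + destruct Hs as [-> | ->], Hs' as [-> | ->]; lra.
    + fold x. rewrite Hsin, Hcos, E1, E2, Ec, Es. split.
      * transitivity (s * c * (b * cosh y)); [ring|]. rewrite <- EA.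
        transitivity ((s' * s') * (s * c * (A y * cosh (b * y)))); [rewrite Hss'|]; ring.
      * transitivity (- s * (t * c) * (b * sinh y)); [ring|]. rewrite <- EB.
        transitivity ((s' * s') * (- s * (t * c) * (B y * sinh (b * y)))); [rewrite Hss'|]; ring.
Qed.

(** The bound [(1 - b) * PI / 2] on the phase gap is half the amount by which the
    length of the strip exceeds its image under [x -> b * x]; a target below it means
    that the image contains no multiple of [PI]. *)
Lemma phase_gap_target_window y t n : 0 < y ->
  phase_gap b (T y) t = phase_target n ->
  IZR n < b * IZR j /\ b * IZR (j + 1) < IZR n + 1.
Proof.
  intros Hy H.
  generalize (phase_gap_bound b (T y) Hb (ratio_tanh_bounds b Hb y Hy) t).
  rewrite H. unfold phase_target. intros Hbd. apply Rabs_def2 in Hbd.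
  generalize PI_RGT_0; intros HPI. rewrite plus_IZR.
  destruct Hbd as [H1 H2].
  assert (b * (IZR j + 1 / 2) - 1 / 2 - IZR n < (1 - b) / 2)
    by (apply Rmult_lt_reg_r with PI; lra).
  assert (- ((1 - b) / 2) < b * (IZR j + 1 / 2) - 1 / 2 - IZR n)
    by (apply Rmult_lt_reg_r with PI; lra).
  lra.
Qed.

(** Going up the curve, in the half [t >= 0], [t] shrinks and [ratio_tanh] grows, and
    both lower the phase gap: two roots on the same phase level are at the same height. *)
Lemma phase_gap_curve_lt y1 y2 t1 t2 : 0 < y1 -> y1 < y2 -> 0 <= t1 -> 0 <= t2 ->
  t1 ^ 2 * (B y1 ^ 2 - 1) = 1 - A y1 ^ 2 ->
  t2 ^ 2 * (B y2 ^ 2 - 1) = 1 - A y2 ^ 2 ->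
  phase_gap b (T y2) t2 < phase_gap b (T y1) t1.
Proof.
  intros Hy1 Hy Ht1 Ht2 H1 H2.
  assert (Hy2 : 0 < y2) by lra.
  assert (HB1 : 1 < B y1) by now apply ratio_sinh_gt1.
  assert (HB : B y1 < B y2) by now apply ratio_sinh_lt.
  assert (HA1 : 0 < A y1) by now apply ratio_cosh_pos.
  assert (HA : A y1 < A y2) by (apply ratio_cosh_lt; lra).
  assert (HT : T y1 < T y2) by now apply ratio_tanh_lt.
  assert (HT1 : b < T y1 < 1) by now apply ratio_tanh_bounds.
  assert (Ht : t2 < t1).
  { destruct (Rlt_or_le t2 t1) as [|Hle]; [assumption|exfalso].
    assert (t1 ^ 2 <= t2 ^ 2) by (apply pow_incr; lra).
    assert (t1 ^ 2 * (B y1 ^ 2 - 1) <= t2 ^ 2 * (B y2 ^ 2 - 1)).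
    { apply Rmult_le_compat; try nra. }
    nra. }
  apply Rle_lt_trans with (phase_gap b (T y1) t2).
  - unfold phase_gap. apply Rplus_le_compat_r.
    assert (t2 / T y2 <= t2 / T y1).
    { apply Rmult_le_compat_l; [lra|]. left. apply Rinv_lt_contravar; nra. }
    destruct (Rle_lt_or_eq_dec _ _ H) as [Hlt | ->]; [|lra].
    left. now apply atan_increasing.
  - now apply phase_gap_lt.
Qed.

Lemma curve_root_unique y1 y2 t1 t2 : 0 < y1 -> 0 < y2 ->
  t1 ^ 2 * (B y1 ^ 2 - 1) = 1 - A y1 ^ 2 ->
  t2 ^ 2 * (B y2 ^ 2 - 1) = 1 - A y2 ^ 2 ->
  phase_gap b (T y1) t1 = phase_gap b (T y2) t2 ->
  y1 = y2 /\ t1 = t2.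
Proof.
  intros Hy1 Hy2 H1 H2 HE.
  assert (HT : forall y, 0 < y -> b < T y < 1) by (intros; now apply ratio_tanh_bounds).
  assert (Hnot : forall y1 y2 t1 t2, 0 < y1 -> y1 < y2 ->
    t1 ^ 2 * (B y1 ^ 2 - 1) = 1 - A y1 ^ 2 ->
    t2 ^ 2 * (B y2 ^ 2 - 1) = 1 - A y2 ^ 2 ->
    phase_gap b (T y1) t1 = phase_gap b (T y2) t2 -> False).
  { clear y1 y2 t1 t2 Hy1 Hy2 H1 H2 HE.
    (* The gap has the sign of [t], so both points lie in the same half of the strip. *)
    intros y1 y2 t1 t2 Hy1 Hy H1 H2 HE.
    assert (Hy2 : 0 < y2) by lra.
    assert (Hsg : forall y t, 0 < y -> t < 0 -> phase_gap b (T y) t < 0).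
    { intros y t Hy0 Ht. rewrite <- (phase_gap_0 b (T y)). apply phase_gap_lt; auto. }
    assert (Hsg' : forall y t, 0 < y -> 0 <= t -> 0 <= phase_gap b (T y) t).
    { intros y t Hy0 [Ht | <-]; [left; apply phase_gap_pos; auto|].
      rewrite phase_gap_0. lra. }
    destruct (Rlt_or_le t1 0) as [Ht1 | Ht1], (Rlt_or_le t2 0) as [Ht2 | Ht2].
    - assert (phase_gap b (T y2) (- t2) < phase_gap b (T y1) (- t1)).
      { apply phase_gap_curve_lt; lra. }
      rewrite !phase_gap_opp in *; lra.
    - generalize (Hsg y1 t1 Hy1 Ht1) (Hsg' y2 t2 Hy2 Ht2). lra.
    - generalize (Hsg y2 t2 Hy2 Ht2) (Hsg' y1 t1 Hy1 Ht1). lra.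
    - generalize (phase_gap_curve_lt y1 y2 t1 t2 Hy1 Hy Ht1 Ht2 H1 H2). lra. }
  destruct (Rtotal_order y1 y2) as [H | [<- | H]].
  - exfalso. exact (Hnot y1 y2 t1 t2 Hy1 H H1 H2 HE).
  - split; [reflexivity|].
    destruct (Rtotal_order t1 t2) as [H | [-> | H]]; [|reflexivity|];
      apply (phase_gap_lt b (T y1) Hb (HT y1 Hy1)) in H; lra.
  - exfalso. exact (Hnot y2 y1 t2 t1 Hy2 H H2 H1 (eq_sym HE)).
Qed.

End Strip.

(** * Non-real roots: existence and uniqueness *)

Section Curve.

Variables (b : R).
Hypothesis Hb : 0 < b < 1.

Let A := ratio_cosh b.
Let B := ratio_sinh b.
Let T := ratio_tanh b.

Lemma ratio_cosh_derivable y : ex_derive A y.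
Proof. unfold A, ratio_cosh. generalize (cosh_pos (b * y)); intros. auto_derive. lra. Qed.

Lemma ratio_sinh_derivable y : 0 < y -> ex_derive B y.
Proof.
  intros Hy. unfold B, ratio_sinh. generalize (sinh_b_pos b Hb y Hy); intros.
  auto_derive. lra.
Qed.

(** The height at which the curve meets the middle line of the strip. *)
Lemma ratio_cosh_reaches_1 : exists y, 0 < y /\ A y = 1.
Proof.
  (* [ratio_cosh Y >= b / 2 * exp ((1 - b) * Y)], and [exp u > u]. *)
  set (Y := 2 / (b * (1 - b))).
  assert (HY : 0 < Y) by (apply Rdiv_lt_0_compat; nra).
  assert (HAY : 1 < A Y).
  { assert (Hc : 0 < cosh (b * Y)) by apply cosh_pos.
    unfold A, ratio_cosh. apply Rlt_div_r; [lra|].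
    assert (Hbig : 2 < b * exp ((1 - b) * Y)).
    { generalize (exp_ineq1 ((1 - b) * Y)). intros H.
      assert (E : b * ((1 - b) * Y) = 2) by (unfold Y; field; lra).
      assert (0 < (1 - b) * Y) by nra. nra. }
    assert (E : exp Y = exp ((1 - b) * Y) * exp (b * Y))
      by (rewrite <- exp_plus; f_equal; ring).
    assert (Hp : exp (- (b * Y)) <= exp (b * Y)).
    { left. apply exp_increasing. nra. }
    generalize (exp_pos (b * Y)) (exp_pos (- Y)). intros.
    unfold cosh. rewrite E. nra. }
  destruct (Ranalysis5.IVT_interv (fun y => A y - 1) 0 Y) as [y [Hy1 Hy2]].
  - intros y _. apply continuity_pt_minus.
    + apply continuity_pt_filterlim.
      apply (ex_derive_continuous (K := R_AbsRing) (V := R_NormedModule)).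
      apply ratio_cosh_derivable.
    + apply continuity_pt_const. now intros ? ?.
  - exact HY.
  - unfold A, ratio_cosh. rewrite Rmult_0_r, cosh_0. lra.
  - lra.
  - exists y. split; [|lra]. destruct Hy1 as [[H | H] _]; [exact H|].
    rewrite <- H in Hy2. unfold A, ratio_cosh in Hy2. rewrite Rmult_0_r, cosh_0 in Hy2. lra.
Qed.

Definition curve_tan (y : R) : R := sqrt ((1 - A y ^ 2) / (B y ^ 2 - 1)).

Lemma curve_tan_sqr y : 0 < y -> A y <= 1 ->
  curve_tan y ^ 2 * (B y ^ 2 - 1) = 1 - A y ^ 2.
Proof.
  intros Hy HA1. assert (HB : 1 < B y) by now apply ratio_sinh_gt1.
  assert (HA : 0 < A y) by now apply ratio_cosh_pos.
  unfold curve_tan. rewrite pow2_sqrt.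
  - field. nra.
  - apply Rle_mult_inv_pos; nra.
Qed.

Lemma phase_gap_curve_continuous y : 0 < y ->
  continuous (fun y => phase_gap b (T y) (curve_tan y)) y.
Proof.
  intros Hy. assert (HB : 1 < B y) by now apply ratio_sinh_gt1.
  assert (HA : 0 < A y) by now apply ratio_cosh_pos.
  assert (HT : b < T y < 1) by now apply ratio_tanh_bounds.
  assert (Hat : forall u, continuous atan u).
  { intros u. apply (ex_derive_continuous (K := R_AbsRing) (V := R_NormedModule)).
    auto_derive; trivial. }
  assert (HdA := ratio_cosh_derivable y). assert (HdB := ratio_sinh_derivable y Hy).
  assert (Hct : continuous curve_tan y).
  { unfold curve_tan. apply continuous_comp; [|apply continuous_sqrt].
    apply (ex_derive_continuous (K := R_AbsRing) (V := R_NormedModule)).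
    auto_derive. repeat split; auto. nra. }
  assert (HcT : continuous (fun y => / T y) y).
  { apply (ex_derive_continuous (K := R_AbsRing) (V := R_NormedModule)).
    unfold T, ratio_tanh. fold A B. auto_derive. repeat split; auto; try lra.
    apply Rgt_not_eq, Rdiv_lt_0_compat; lra. }
  unfold phase_gap. apply (continuous_minus (V := R_NormedModule)).
  - apply (continuous_comp (fun y => curve_tan y / T y) atan); [|apply Hat].
    now apply (continuous_mult (K := R_AbsRing)).
  - apply (continuous_mult (K := R_AbsRing) (fun _ => b) (fun y => atan (curve_tan y))).
    + apply continuous_const.
    + now apply (continuous_comp curve_tan atan).
Qed.

(** At the bottom of the curve [ratio_sinh] tends to [1] while [ratio_cosh] stays
    away from it, so [curve_tan] blows up and the phase gap approaches its supremum
    [(1 - b) * PI / 2]; at the top the gap is [0]. *)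
Lemma curve_phase_gap_onto_pos g : 0 <= g < (1 - b) * PI / 2 ->
  exists y t, 0 < y /\ t ^ 2 * (B y ^ 2 - 1) = 1 - A y ^ 2 /\
    phase_gap b (T y) t = g.
Proof.
  intros [Hg0 Hg1].
  destruct ratio_cosh_reaches_1 as [ys [Hys HAs]].
  destruct Hg0 as [Hg0 | <-].
  2: { exists ys, 0. rewrite HAs, phase_gap_0. repeat split; [exact Hys | ring]. }
  set (psi := g / (1 - b)).
  assert (Hpsi : 0 < psi < PI / 2).
  { unfold psi. split; [apply Rdiv_lt_0_compat; lra | apply Rlt_div_l; lra]. }
  set (M := tan psi).
  assert (HM : 0 < M) by (apply tan_gt_0; lra).
  assert (H0 : exists y0, 0 < y0 < ys /\ 0 < (1 - A y0 ^ 2) - M ^ 2 * (cosh y0 ^ 2 - 1)).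
  { assert (Hc : continuous (fun y => (1 - A y ^ 2) - M ^ 2 * (cosh y ^ 2 - 1)) 0).
    { apply (ex_derive_continuous (K := R_AbsRing) (V := R_NormedModule)).
      assert (HdA := ratio_cosh_derivable 0). auto_derive. auto. }
    assert (Hl : locally ((1 - A 0 ^ 2) - M ^ 2 * (cosh 0 ^ 2 - 1)) (fun v => 0 < v)).
    { apply open_gt. unfold A, ratio_cosh. rewrite Rmult_0_r, cosh_0. nra. }
    destruct (Hc _ Hl) as [d Hd].
    exists (Rmin d ys / 2).
    assert (Hmin : 0 < Rmin d ys) by (apply Rmin_case; [apply cond_pos | lra]).
    generalize (Rmin_l d ys) (Rmin_r d ys). intros.
    split; [lra|]. apply (Hd (Rmin d ys / 2)).
    unfold ball; simpl. unfold AbsRing_ball, abs, minus, plus, opp; simpl.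
    rewrite Rabs_pos_eq; lra. }
  destruct H0 as [y0 [[Hy0 Hy0s] Hpos]].
  assert (HA1 : forall y, 0 < y <= ys -> A y <= 1).
  { intros y [Hy [Hlt | ->]]; [|lra]. rewrite <- HAs. left.
    apply ratio_cosh_lt; lra. }
  destruct (Ranalysis5.IVT_interv (fun y => g - phase_gap b (T y) (curve_tan y)) y0 ys)
    as [y [Hy1 Hy2]].
  - intros y Hy. apply continuity_pt_minus.
    + apply continuity_pt_const. now intros ? ?.
    + apply continuity_pt_filterlim. apply phase_gap_curve_continuous. lra.
  - exact Hy0s.
  - assert (HB : 1 < B y0) by now apply ratio_sinh_gt1.
    assert (HBc : B y0 <= cosh y0) by now apply ratio_sinh_le_cosh.
    assert (HT : b < T y0 < 1) by now apply ratio_tanh_bounds.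
    assert (Hct : M < curve_tan y0).
    { unfold curve_tan. rewrite <- (sqrt_pow2 M) by lra. apply sqrt_lt_1_alt.
      split; [apply pow2_ge_0|]. apply (Rlt_div_r (M ^ 2)); [nra|].
      assert (M ^ 2 * (B y0 ^ 2 - 1) <= M ^ 2 * (cosh y0 ^ 2 - 1)).
      { apply Rmult_le_compat_l; [apply pow2_ge_0|nra]. }
      lra. }
    assert (H1 : psi < atan (curve_tan y0)).
    { rewrite <- (atan_tan psi) by lra. now apply atan_increasing. }
    assert (H2 : atan (curve_tan y0) < atan (curve_tan y0 / T y0)).
    { apply atan_increasing. apply Rlt_div_r; nra. }
    assert (E : g = (1 - b) * psi) by (unfold psi; field; lra).
    assert ((1 - b) * psi < (1 - b) * atan (curve_tan y0))
      by (apply Rmult_lt_compat_l; lra).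
    unfold phase_gap. lra.
  - assert (E : curve_tan ys = 0).
    { unfold curve_tan. rewrite HAs. unfold Rdiv.
      replace (1 - 1 ^ 2) with 0 by ring. rewrite Rmult_0_l. apply sqrt_0. }
    rewrite E, phase_gap_0. lra.
  - exists y, (curve_tan y). assert (0 < y) by lra. repeat split; [lra | | lra].
    apply curve_tan_sqr; [lra | apply HA1; lra].
Qed.

Lemma curve_phase_gap_onto g : Rabs g < (1 - b) * PI / 2 ->
  exists y t, 0 < y /\ t ^ 2 * (B y ^ 2 - 1) = 1 - A y ^ 2 /\
    phase_gap b (T y) t = g.
Proof.
  intros Hg. destruct (Rle_or_lt 0 g) as [H | H].
  - apply curve_phase_gap_onto_pos. rewrite Rabs_pos_eq in Hg; lra.
  - destruct (curve_phase_gap_onto_pos (- g)) as [y [t [Hy [Hc E]]]].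
    { rewrite Rabs_left in Hg; lra. }
    exists y, (- t). repeat split; [exact Hy | | ].
    + rewrite <- Hc. ring.
    + rewrite phase_gap_opp, E. ring.
Qed.

End Curve.

Lemma strip_point_onto j x :
  IZR j * PI < x < IZR (j + 1) * PI -> exists t, x = strip_point j t.
Proof.
  rewrite plus_IZR. intros Hx. exists (tan (x - IZR j * PI - PI / 2)).
  unfold strip_point. rewrite atan_tan; lra.
Qed.

Lemma strip_point_bounds j t :
  IZR j * PI < strip_point j t < IZR (j + 1) * PI.
Proof. rewrite plus_IZR. unfold strip_point. generalize (atan_bound t). lra. Qed.

Section Upper.

Variables (b : R) (j : Z).
Hypothesis Hb : 0 < b < 1.

Lemma upper_root_window x y : IZR j * PI < x < IZR (j + 1) * PI -> 0 < y ->
  scaled_sine_root b x y ->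
  exists n : Z, IZR n < b * IZR j /\ b * IZR (j + 1) < IZR n + 1.
Proof.
  intros Hx Hy Hr. destruct (strip_point_onto j x Hx) as [t ->].
  apply (root_iff_phase_gap b j Hb y t Hy) in Hr. destruct Hr as [_ [n Hn]].
  exists n. now apply (phase_gap_target_window b j Hb y t).
Qed.

Lemma upper_root_exists_unique n :
  IZR n < b * IZR j -> b * IZR (j + 1) < IZR n + 1 ->
  exists x0 y0, IZR j * PI < x0 < IZR (j + 1) * PI /\ 0 < y0 /\
    scaled_sine_root b x0 y0 /\
    forall x y, IZR j * PI < x < IZR (j + 1) * PI -> 0 < y ->
      scaled_sine_root b x y -> x = x0 /\ y = y0.
Proof.
  intros Hn1 Hn2. rewrite plus_IZR in Hn2.
  assert (Hg : Rabs (phase_target b j n) < (1 - b) * PI / 2).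
  { unfold phase_target. generalize PI_RGT_0; intros. apply Rabs_def1; nra. }
  destruct (curve_phase_gap_onto b Hb _ Hg) as [y0 [t0 [Hy0 [Hc0 E0]]]].
  exists (strip_point j t0), y0. split; [apply strip_point_bounds|].
  split; [exact Hy0|]. split.
  - apply root_iff_phase_gap; auto. split; [exact Hc0|]. now exists n.
  - intros x y Hx Hy Hr. destruct (strip_point_onto j x Hx) as [t ->].
    apply (root_iff_phase_gap b j Hb y t Hy) in Hr. destruct Hr as [Hc [n' En]].
    destruct (phase_gap_target_window b j Hb y t n' Hy En) as [Hw1 Hw2].
    rewrite plus_IZR in Hw2.
    (* The window is shorter than [1], so it determines the integer. *)
    assert (n' = n).
    { assert (n' < n + 1)%Z by (apply lt_IZR; rewrite plus_IZR; lra).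
      assert (n < n' + 1)%Z by (apply lt_IZR; rewrite plus_IZR; lra). lia. }
    subst n'.
    destruct (curve_root_unique b Hb y y0 t t0) as [-> ->]; auto.
    now rewrite En.
Qed.

End Upper.

(** * Real roots *)

Lemma sin_strip_neq_0 j x : IZR j * PI < x < IZR (j + 1) * PI -> sin x <> 0.
Proof.
  intros [H1 H2] H. apply sin_eq_0_0 in H. destruct H as [n ->].
  generalize PI_RGT_0; intros HPI.
  apply Rmult_lt_reg_r in H1; [|lra]. apply Rmult_lt_reg_r in H2; [|lra].
  apply lt_IZR in H1, H2. lia.
Qed.

Lemma sin_IZR_PI n : sin (IZR n * PI) = 0.
Proof. apply sin_eq_0_1. now exists n. Qed.

(** Where [sin x] vanishes the equation forces [b * |sinh y| = |sinh (b * y)|], which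
    by strict convexity happens at [y = 0] only. *)
Lemma scaled_sine_root_sin_0 b x y : 0 < b < 1 ->
  sin x = 0 -> scaled_sine_root b x y -> y = 0.
Proof.
  intros Hb Hx [e [He [H1 H2]]]. rewrite Hx in H1.
  assert (Hc : 0 < cosh (b * y)) by apply cosh_pos.
  assert (Hs : sin (b * x) = 0).
  { apply Rmult_eq_reg_r with (e * cosh (b * y)); [destruct He as [-> | ->]; lra|].
    destruct He as [-> | ->]; lra. }
  assert (Hsq : b ^ 2 * sinh y ^ 2 = sinh (b * y) ^ 2).
  { generalize (sin2_cos2 x) (sin2_cos2 (b * x)). rewrite Hx, Hs. unfold Rsqr.
    intros C1 C2.
    transitivity ((b * cos x * sinh y) ^ 2).
    - transitivity ((0 * 0 + cos x * cos x) * (b ^ 2 * sinh y ^ 2)); [rewrite C1|]; ring.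
    - rewrite H2.
      transitivity ((e * e) * (0 * 0 + cos (b * x) * cos (b * x)) * sinh (b * y) ^ 2);
        [ring|]. rewrite C2. destruct He as [-> | ->]; ring. }
  assert (Hpos : forall u, 0 < u -> b ^ 2 * sinh u ^ 2 = sinh (b * u) ^ 2 -> False).
  { intros u Hu E. generalize (sinh_scale_lt b Hb u Hu) (sinh_b_pos b Hb u Hu). nra. }
  destruct (Rtotal_order y 0) as [H | [H | H]]; [exfalso|exact H|exfalso].
  - apply (Hpos (- y)); [lra|]. replace (b * - y) with (- (b * y)) by ring.
    rewrite !sinh_opp. lra.
  - now apply (Hpos y).
Qed.

Section RealRoots.

Variable b : R.
Hypothesis Hb : 0 < b < 1.

(** [b * sin x = +- sin (b * x)] says that [b * x] and [asin (b * sin x)] have equal or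
    opposite sines, that is, that their sum or difference is a multiple of [PI]. *)
Definition real_phase (e x : R) : R := b * x + e * asin (b * sin x).

Lemma scaled_sin_bounds x : -1 < b * sin x < 1.
Proof. generalize (SIN_bound x). nra. Qed.

Lemma real_root_iff_phase x :
  scaled_sine_root b x 0 <->
  exists e, (e = 1 \/ e = -1) /\ exists n, real_phase e x = IZR n * PI.
Proof.
  assert (Hpsi : sin (asin (b * sin x)) = b * sin x).
  { apply sin_asin. generalize (scaled_sin_bounds x). lra. }
  unfold real_phase. set (psi := asin (b * sin x)) in *. split.
  - intros [e [He [H _]]]. rewrite Rmult_0_r, cosh_0, !Rmult_1_r in H.
    assert (Hprod : sin (b * x + psi) * sin (b * x - psi) = 0).
    { rewrite sin_plus, sin_minus.
      transitivity (sin (b * x) ^ 2 * (1 - sin psi ^ 2) - (1 - sin (b * x) ^ 2) * sin psi ^ 2).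
      - generalize (sin2_cos2 (b * x)) (sin2_cos2 psi). unfold Rsqr. intros E1 E2.
        rewrite <- E1 at 2. rewrite <- E2 at 1. ring.
      - rewrite Hpsi, H. destruct He as [-> | ->]; ring. }
    apply Rmult_integral in Hprod.
    destruct Hprod as [E | E]; apply sin_eq_0_0 in E; destruct E as [n Hn].
    + exists 1. split; [now left|]. exists n. lra.
    + exists (-1). split; [now right|]. exists n. lra.
  - intros [e [He [n Hn]]].
    destruct (trig_shift_IZR n) as [s [Hs Hsh]].
    destruct (Hsh (- e * psi)) as [Es _].
    replace (IZR n * PI + - e * psi) with (b * x) in Es by lra.
    assert (Ee : sin (- e * psi) = - e * (b * sin x)).
    { rewrite <- Hpsi. destruct He as [-> | ->].
      - replace (- (1) * psi) with (- psi) by ring. rewrite sin_neg. ring.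
      - replace (- (-1) * psi) with psi by ring. ring. }
    exists (- s * e). split.
    + destruct Hs as [-> | ->], He as [-> | ->]; lra.
    + rewrite Rmult_0_r, sinh_0, cosh_0, Es, Ee. split; [|ring].
      destruct Hs as [-> | ->], He as [-> | ->]; ring.
Qed.

Lemma real_phase_derive e x :
  is_derive (real_phase e) x (b + e * (b * cos x / sqrt (1 - (b * sin x) ^ 2))).
Proof.
  assert (Hasin : is_derive asin (b * sin x) (1 / sqrt (1 - (b * sin x)²))).
  { apply is_derive_Reals. apply (derive_pt_eq_1 _ _ _ (derivable_pt_asin _ (scaled_sin_bounds x))).
    apply derive_pt_asin. }
  unfold real_phase. apply (is_derive_plus (K := R_AbsRing) (V := R_NormedModule)).
  - auto_derive; trivial. ring.
  - apply (is_derive_scal (fun x => asin (b * sin x))).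
    replace (b * cos x / sqrt (1 - (b * sin x) ^ 2))
      with (scal (b * cos x) (1 / sqrt (1 - (b * sin x)²))).
    + apply (is_derive_comp asin (fun x => b * sin x)); [exact Hasin|].
      auto_derive; trivial. ring.
    + unfold scal; simpl; unfold mult; simpl.
      replace (b * sin x * (b * sin x * 1)) with (b * sin x)² by (unfold Rsqr; ring).
      unfold Rdiv. ring.
Qed.

(** [asin (b * sin x)] varies more slowly than [b * x]: its derivative is
    [b * cos x / sqrt (1 - (b * sin x) ^ 2)], which is below [b] in absolute value
    wherever [sin x] does not vanish. *)
Lemma real_phase_lt e j x1 x2 : (e = 1 \/ e = -1) ->
  IZR j * PI <= x1 -> x1 < x2 -> x2 <= IZR (j + 1) * PI ->
  real_phase e x1 < real_phase e x2.
Proof.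
  intros He H1 H12 H2. revert H12.
  apply (increasing_of_derive (real_phase e)
    (fun x => b + e * (b * cos x / sqrt (1 - (b * sin x) ^ 2)))).
  - intros z _. apply real_phase_derive.
  - intros z Hz.
    assert (Hs : sin z <> 0) by (apply (sin_strip_neq_0 j); lra).
    assert (Hs2 : 0 < sin z ^ 2) by (generalize (pow_nonzero _ 2 Hs) (pow2_ge_0 (sin z)); lra).
    assert (Hc : cos z ^ 2 = 1 - sin z ^ 2).
    { generalize (sin2_cos2 z). unfold Rsqr. lra. }
    assert (Hlt : cos z ^ 2 < 1 - (b * sin z) ^ 2).
    { assert (0 < (1 - b ^ 2) * sin z ^ 2) by (apply Rmult_lt_0_compat; nra).
      rewrite Rpow_mult_distr. lra. }
    set (r := sqrt (1 - (b * sin z) ^ 2)).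
    assert (Hr : Rabs (cos z) < r).
    { unfold r. rewrite <- sqrt_Rsqr_abs. apply sqrt_lt_1_alt. unfold Rsqr.
      generalize (pow2_ge_0 (cos z)). lra. }
    assert (Hr0 : 0 < r) by (generalize (Rabs_pos (cos z)); lra).
    assert (Hq : -1 < cos z / r < 1).
    { apply Rabs_def2 in Hr. split.
      - apply (Rlt_div_r (-1)); lra.
      - apply (Rlt_div_l _ 1); lra. }
    replace (b * cos z / r) with (b * (cos z / r)) by (unfold Rdiv; ring).
    destruct He as [-> | ->]; nra.
Qed.

Lemma real_phase_at_node e j : real_phase e (IZR j * PI) = b * IZR j * PI.
Proof. unfold real_phase. rewrite sin_IZR_PI, Rmult_0_r, asin_0. ring. Qed.

(** The phase runs from [b * j * PI] to [b * (j + 1) * PI] over the strip, whatever the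
    sign [e]. *)
Lemma real_phase_window e j x n : (e = 1 \/ e = -1) ->
  IZR j * PI < x < IZR (j + 1) * PI -> real_phase e x = IZR n * PI ->
  b * IZR j < IZR n < b * IZR (j + 1).
Proof.
  intros He Hx Hn. generalize PI_RGT_0; intros HPI.
  assert (E1 : real_phase e (IZR j * PI) < real_phase e x)
    by (apply (real_phase_lt e j); lra).
  assert (E2 : real_phase e x < real_phase e (IZR (j + 1) * PI))
    by (apply (real_phase_lt e j); lra).
  rewrite real_phase_at_node, Hn in E1. rewrite real_phase_at_node, Hn in E2.
  split; apply Rmult_lt_reg_r with PI; lra.
Qed.

Lemma real_root_window j x : IZR j * PI < x < IZR (j + 1) * PI ->
  scaled_sine_root b x 0 -> exists n, b * IZR j < IZR n < b * IZR (j + 1).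
Proof.
  intros Hx Hr. apply real_root_iff_phase in Hr. destruct Hr as [e [He [n Hn]]].
  exists n. now apply (real_phase_window e j x).
Qed.

Lemma real_phase_reaches e j n : (e = 1 \/ e = -1) ->
  b * IZR j < IZR n < b * IZR (j + 1) ->
  exists x, IZR j * PI < x < IZR (j + 1) * PI /\ real_phase e x = IZR n * PI.
Proof.
  intros He Hn. generalize PI_RGT_0; intros HPI.
  assert (Hl : real_phase e (IZR j * PI) - IZR n * PI < 0)
    by (rewrite real_phase_at_node; nra).
  assert (Hu : 0 < real_phase e (IZR (j + 1) * PI) - IZR n * PI)
    by (rewrite real_phase_at_node; nra).
  destruct (Ranalysis5.IVT_interv (fun x => real_phase e x - IZR n * PI)
              (IZR j * PI) (IZR (j + 1) * PI)) as [x [Hx1 Hx2]]; auto.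
  - intros x _. apply continuity_pt_minus.
    + apply continuity_pt_filterlim.
      apply (ex_derive_continuous (K := R_AbsRing) (V := R_NormedModule)).
      eexists. apply real_phase_derive.
    + apply continuity_pt_const. now intros ? ?.
  - apply Rmult_lt_compat_r; [lra|]. rewrite plus_IZR. lra.
  - exists x. split; [|lra].
    destruct Hx1 as [[H1 | H1] [H2 | H2]]; try lra; subst x; lra.
Qed.

(** Each of the two phases passes once through [n * PI], and not at the same point,
    because they differ by [2 * asin (b * sin x)]. *)
Lemma two_real_roots j n : b * IZR j < IZR n < b * IZR (j + 1) ->
  exists x1 x2, x1 <> x2 /\
    IZR j * PI < x1 < IZR (j + 1) * PI /\ IZR j * PI < x2 < IZR (j + 1) * PI /\
    scaled_sine_root b x1 0 /\ scaled_sine_root b x2 0 /\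
    forall x, IZR j * PI < x < IZR (j + 1) * PI -> scaled_sine_root b x 0 ->
      x = x1 \/ x = x2.
Proof.
  intros Hn.
  assert (Hp : 1 = 1 \/ 1 = -1) by (now left).
  assert (Hm : -1 = 1 \/ -1 = -1) by (now right).
  destruct (real_phase_reaches 1 j n Hp Hn) as [x1 [Hx1 E1]].
  destruct (real_phase_reaches (-1) j n Hm Hn) as [x2 [Hx2 E2]].
  exists x1, x2. split.
  - intros <-. unfold real_phase in E1, E2.
    assert (E : asin (b * sin x1) = 0) by lra.
    assert (Hs : b * sin x1 = 0).
    { rewrite <- (sin_asin (b * sin x1)) by (generalize (scaled_sin_bounds x1); lra).
      rewrite E. apply sin_0. }
    apply Rmult_integral in Hs. destruct Hs as [Hs | Hs]; [lra|].
    now apply (sin_strip_neq_0 j x1).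
  - split; [exact Hx1|]. split; [exact Hx2|].
    split; [apply real_root_iff_phase; exists 1; split; [exact Hp | now exists n]|].
    split; [apply real_root_iff_phase; exists (-1); split; [exact Hm | now exists n]|].
    intros x Hx Hr. apply real_root_iff_phase in Hr. destruct Hr as [e [He [n' Hn']]].
    generalize (real_phase_window e j x n' He Hx Hn'). intros Hw.
    assert (n' = n).
    { rewrite plus_IZR in *.
      assert (n' < n + 1)%Z by (apply lt_IZR; rewrite plus_IZR; lra).
      assert (n < n' + 1)%Z by (apply lt_IZR; rewrite plus_IZR; lra). lia. }
    subst n'.
    assert (Hinj : forall x', IZR j * PI < x' < IZR (j + 1) * PI ->
              real_phase e x' = IZR n * PI -> x = x').
    { intros x' Hx' E'. destruct (Rtotal_order x x') as [H | [H | H]]; [|exact H|];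
        apply (real_phase_lt e j) in H; auto; lra. }
    destruct He as [-> | ->]; [left | right]; now apply Hinj.
Qed.

End RealRoots.

(** * Roots in a strip *)

Section Counting.

Variables (b : R) (j : Z).
Hypothesis Hb : 0 < b < 1.

Lemma root_cases x y : scaled_sine_root b x y ->
  y = 0 \/ exists y', 0 < y' /\ scaled_sine_root b x y' /\ (y = y' \/ y = - y').
Proof.
  intros Hr. destruct (Rtotal_order y 0) as [H | [H | H]].
  - right. exists (- y). split; [lra|]. split; [now apply scaled_sine_root_opp | lra].
  - now left.
  - right. exists y. auto.
Qed.

(** A multiple of [PI] inside the image of the strip under [x -> b * x] gives real
    roots, and leaves no room for the window needed by a non-real one. *)
Lemma strip_roots_real n : b * IZR j < IZR n < b * IZR (j + 1) ->
  exists x1 x2, x1 <> x2 /\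
    IZR j * PI < x1 < IZR (j + 1) * PI /\ IZR j * PI < x2 < IZR (j + 1) * PI /\
    forall x y, IZR j * PI < x < IZR (j + 1) * PI ->
      (scaled_sine_root b x y <-> y = 0 /\ (x = x1 \/ x = x2)).
Proof.
  intros Hn. destruct (two_real_roots b Hb j n Hn)
    as [x1 [x2 [Hne [Hx1 [Hx2 [Hr1 [Hr2 Hu]]]]]]].
  exists x1, x2. repeat split; try lra; auto.
  - destruct (root_cases x y H0) as [-> | [y' [Hy' [Hr' _]]]]; [reflexivity|exfalso].
    destruct (upper_root_window b j Hb x y' H Hy' Hr') as [n' [W1 W2]].
    assert (n' < n)%Z by (apply lt_IZR; lra).
    assert (n < n' + 1)%Z by (apply lt_IZR; rewrite (plus_IZR n'); lra). lia.
  - destruct (root_cases x y H0) as [-> | [y' [Hy' [Hr' _]]]]; [now apply Hu|exfalso].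
    destruct (upper_root_window b j Hb x y' H Hy' Hr') as [n' [W1 W2]].
    assert (n' < n)%Z by (apply lt_IZR; lra).
    assert (n < n' + 1)%Z by (apply lt_IZR; rewrite (plus_IZR n'); lra). lia.
  - intros [-> [-> | ->]]; assumption.
Qed.

Lemma strip_roots_conjugate n : IZR n < b * IZR j -> b * IZR (j + 1) < IZR n + 1 ->
  exists x0 y0, 0 < y0 /\ IZR j * PI < x0 < IZR (j + 1) * PI /\
    forall x y, IZR j * PI < x < IZR (j + 1) * PI ->
      (scaled_sine_root b x y <-> x = x0 /\ (y = y0 \/ y = - y0)).
Proof.
  intros Hn1 Hn2. destruct (upper_root_exists_unique b j Hb n Hn1 Hn2)
    as [x0 [y0 [Hx0 [Hy0 [Hr0 Hu]]]]].
  exists x0, y0. split; [exact Hy0|]. split; [exact Hx0|].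
  intros x y Hx. split.
  - intros Hr. destruct (root_cases x y Hr) as [-> | [y' [Hy' [Hr' Hyy]]]].
    + exfalso. destruct (real_root_window b Hb j x Hx Hr) as [n' [W1 W2]].
      assert (n < n')%Z by (apply lt_IZR; lra).
      assert (n' < n + 1)%Z by (apply lt_IZR; rewrite (plus_IZR n); lra). lia.
    + destruct (Hu x y' Hx Hy' Hr') as [-> ->]. auto.
  - intros [-> [-> | ->]]; [assumption | now apply scaled_sine_root_opp].
Qed.

(** When an end of the image of the strip is a multiple of [PI], the image has no such
    multiple inside, yet fits in no gap between consecutive ones with room to spare at
    both ends; this excludes real and non-real roots respectively. *)
Lemma strip_no_root_beside_node :
  (exists n, b * IZR j = IZR n \/ b * IZR (j + 1) = IZR n) ->
  forall x y, IZR j * PI < x < IZR (j + 1) * PI -> ~ scaled_sine_root b x y.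
Proof.
  intros [n Hn] x y Hx Hr. rewrite plus_IZR in Hn.
  destruct (root_cases x y Hr) as [-> | [y' [Hy' [Hr' _]]]].
  - destruct (real_root_window b Hb j x Hx Hr) as [n' W]. rewrite plus_IZR in W.
    assert (n - 1 < n')%Z by (apply lt_IZR; rewrite minus_IZR; lra).
    assert (n' < n + 1)%Z by (apply lt_IZR; rewrite plus_IZR; lra).
    assert (n' = n) by lia. subst n'. lra.
  - destruct (upper_root_window b j Hb x y' Hx Hy' Hr') as [n' W]. rewrite plus_IZR in W.
    assert (n' < n)%Z by (apply lt_IZR; lra).
    assert (n < n' + 1)%Z by (apply lt_IZR; rewrite plus_IZR; lra). lia.
Qed.

End Counting.

Lemma double_strip_root_at_node b j n x y : 0 < b < 1 -> b * IZR j = IZR n ->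
  IZR (j - 1) * PI < x < IZR (j + 1) * PI -> scaled_sine_root b x y ->
  x = IZR j * PI /\ y = 0.
Proof.
  intros Hb Hn Hx Hr. destruct (Rtotal_order x (IZR j * PI)) as [H | [H | H]].
  - exfalso. apply (strip_no_root_beside_node b (j - 1) Hb) with x y; auto.
    + exists n. right. replace (j - 1 + 1)%Z with j by lia. exact Hn.
    + replace (j - 1 + 1)%Z with j by lia. lra.
  - split; [exact H|]. apply (scaled_sine_root_sin_0 b x y Hb); [|exact Hr].
    rewrite H. apply sin_IZR_PI.
  - exfalso. apply (strip_no_root_beside_node b j Hb) with x y; auto.
    + exists n. now left.
    + lra.
Qed.

(** * Complex exponential, sine and cosine *)

Lemma Cexp_plus z w : Cexp (z + w)%C = (Cexp z * Cexp w)%C.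
Proof.
  destruct z as [a b], w as [c d]. unfold Cexp, Cmult, RtoC; simpl.
  rewrite exp_plus, cos_plus, sin_plus. apply injective_projections; simpl; ring.
Qed.

Lemma Cexp_0 : Cexp (RtoC 0) = RtoC 1.
Proof.
  unfold Cexp, Cmult, RtoC; simpl. rewrite exp_0, cos_0, sin_0.
  apply injective_projections; simpl; ring.
Qed.

Lemma Cmod_le_abs (z : C) : Cmod z <= Rabs (Re z) + Rabs (Im z).
Proof.
  replace z with (RtoC (Re z) + Ci * RtoC (Im z))%C at 1.
  - eapply Rle_trans; [apply Cmod_triangle|].
    rewrite Cmod_mult, Cmod_Ci, !Cmod_R. lra.
  - destruct z; unfold Cplus, Cmult, RtoC, Ci; simpl.
    apply injective_projections; simpl; ring.
Qed.

Lemma first_order_bound (f : R -> R) (l : R) (eps : posreal) :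
  derivable_pt_lim f 0 l ->
  exists d : posreal, forall u, Rabs u < d -> Rabs (f u - f 0 - l * u) <= eps * Rabs u.
Proof.
  intros Hf. destruct (Hf eps (cond_pos eps)) as [d Hd]. exists d. intros u Hu.
  destruct (Req_dec u 0) as [-> | Hu0].
  - rewrite Rabs_R0. replace (f 0 - f 0 - l * 0) with 0 by ring. rewrite Rabs_R0. lra.
  - replace (f u - f 0 - l * u) with (((f (0 + u) - f 0) / u - l) * u)
      by (rewrite Rplus_0_l; field; assumption).
    rewrite Rabs_mult. apply Rmult_le_compat_r; [apply Rabs_pos|].
    left. now apply Hd.
Qed.

(** Writing [h = u + i v], the remainder has parts [r1 + exp u * r3] and
    [exp u * r2 + (exp u - 1) * v], with [r1], [r2], [r3] the first-order remainders of
    [exp u], [sin v], [cos v]; the constant [9] collects the resulting multiples. *)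
Lemma Cexp_first_order (eps : posreal) :
  exists d : posreal, forall h : C, Cmod h < d ->
    Cmod (Cexp h - 1 - h)%C <= eps * Cmod h.
Proof.
  assert (He9 : 0 < Rmin 1 (eps / 9)).
  { apply Rmin_pos; [lra|]. generalize (cond_pos eps). lra. }
  set (e := mkposreal _ He9).
  assert (Hel : e <= 1) by apply Rmin_l.
  assert (Her : e <= eps / 9) by apply Rmin_r.
  assert (Hep : 0 < e) by apply cond_pos.
  destruct (first_order_bound exp 1 e) as [d1 H1].
  { generalize (derivable_pt_lim_exp 0). now rewrite exp_0. }
  destruct (first_order_bound sin 1 e) as [d2 H2].
  { generalize (derivable_pt_lim_sin 0). now rewrite cos_0. }
  destruct (first_order_bound cos 0 e) as [d3 H3].
  { generalize (derivable_pt_lim_cos 0). now rewrite sin_0, Ropp_0. }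
  assert (Hd : 0 < Rmin (Rmin d1 d2) (Rmin d3 e)).
  { apply Rmin_pos; apply Rmin_pos; apply cond_pos. }
  exists (mkposreal _ Hd). intros [u v] Hh.
  change (Cmod (u, v) < Rmin (Rmin d1 d2) (Rmin d3 e)) in Hh.
  generalize (Rmin_l (Rmin d1 d2) (Rmin d3 e)) (Rmin_r (Rmin d1 d2) (Rmin d3 e))
    (Rmin_l d1 d2) (Rmin_r d1 d2) (Rmin_l d3 e) (Rmin_r d3 e). intros.
  generalize (Rmax_Cmod (u, v)). cbn [fst snd]. intros Hmax.
  generalize (Rmax_l (Rabs u) (Rabs v)) (Rmax_r (Rabs u) (Rabs v)). intros Hu Hv.
  set (m := Cmod (u, v)) in *.
  assert (Hm0 : 0 <= m) by apply Cmod_ge_0.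
  specialize (H1 u ltac:(lra)). specialize (H2 v ltac:(lra)). specialize (H3 v ltac:(lra)).
  rewrite exp_0 in H1. rewrite sin_0 in H2. rewrite cos_0 in H3.
  generalize (Rabs_pos u) (Rabs_pos v). intros Hu0 Hv0.
  set (r1 := exp u - 1 - 1 * u) in *. set (r2 := sin v - 0 - 1 * v) in *.
  set (r3 := cos v - 1 - 0 * v) in *.
  assert (B1 : Rabs r1 <= e * m) by nra.
  assert (B2 : Rabs r2 <= e * m) by nra.
  assert (B3 : Rabs r3 <= e * m) by nra.
  assert (Hexp : Rabs (exp u) <= 3).
  { replace (exp u) with (1 + (u + r1)) by (unfold r1; ring).
    eapply Rle_trans; [apply Rabs_triang|].
    generalize (Rabs_triang u r1). rewrite Rabs_R1. nra. }
  eapply Rle_trans; [apply Cmod_le_abs|].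
  replace (Re (Cexp (u, v) - 1 - (u, v))%C) with (r1 + exp u * r3)
    by (unfold r1, r3, Cexp, Re; simpl; ring).
  replace (Im (Cexp (u, v) - 1 - (u, v))%C) with (exp u * r2 + (u + r1) * v)
    by (unfold r1, r2, Cexp, Im; simpl; ring).
  assert (K1 : Rabs (r1 + exp u * r3) <= e * m + 3 * (e * m)).
  { eapply Rle_trans; [apply Rabs_triang|]. rewrite Rabs_mult.
    generalize (Rabs_pos (exp u)) (Rabs_pos r3). intros.
    assert (Rabs (exp u) * Rabs r3 <= 3 * (e * m)) by (apply Rmult_le_compat; lra). lra. }
  assert (K2 : Rabs (exp u * r2 + (u + r1) * v) <= 3 * (e * m) + 2 * (e * m)).
  { eapply Rle_trans; [apply Rabs_triang|]. rewrite !Rabs_mult.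
    generalize (Rabs_pos (exp u)) (Rabs_pos r2) (Rabs_pos (u + r1)) (Rabs_triang u r1). intros.
    assert (Rabs (exp u) * Rabs r2 <= 3 * (e * m)) by (apply Rmult_le_compat; lra).
    assert (Rabs (u + r1) <= 2 * e) by nra.
    assert (Rabs (u + r1) * Rabs v <= (2 * e) * m) by (apply Rmult_le_compat; lra). lra. }
  nra.
Qed.

Lemma is_derive_Cexp (z : C) :
  @is_derive C_AbsRing C_NormedModule Cexp z (Cexp z).
Proof.
  split; [apply is_linear_scal_l|].
  intros x Hx.
  apply (is_filter_lim_locally_unique (V := AbsRing_NormedModule C_AbsRing)) in Hx.
  subst x. intros eps.
  assert (Hc : 0 < eps / (Cmod (Cexp z) + 1)).
  { apply Rdiv_lt_0_compat; [apply cond_pos | generalize (Cmod_ge_0 (Cexp z)); lra]. }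
  destruct (Cexp_first_order (mkposreal _ Hc)) as [d Hd]. exists d. intros w Hw.
  change (Cmod (Cexp w - Cexp z - (w - z) * Cexp z)%C <= eps * Cmod (w - z)%C).
  change (Cmod (w - z)%C < d) in Hw. specialize (Hd _ Hw). simpl in Hd.
  replace (Cexp w) with (Cexp z * Cexp (w - z))%C
    by (rewrite <- Cexp_plus; f_equal; ring).
  replace (Cexp z * Cexp (w - z) - Cexp z - (w - z) * Cexp z)%C
    with (Cexp z * (Cexp (w - z) - 1 - (w - z)))%C by ring.
  rewrite Cmod_mult. generalize (Cmod_ge_0 (Cexp z)) (Cmod_ge_0 (w - z)). intros.
  eapply Rle_trans; [apply Rmult_le_compat_l; [lra | exact Hd]|].
  apply Rle_trans with ((Cmod (Cexp z) + 1) * (eps / (Cmod (Cexp z) + 1) * Cmod (w - z)%C)).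
  - apply Rmult_le_compat_r; [|lra]. apply Rmult_le_pos; lra.
  - right. field. lra.
Qed.

Definition Ccos (z : C) : C := ((Cexp (Ci * z) + Cexp (- (Ci * z))) / 2)%C.

Lemma Ci_neq_0 : Ci <> 0.
Proof. intros H. injection H. lra. Qed.

Lemma Ci_sqr : (Ci * Ci = - (1))%C.
Proof. unfold Ci, Cmult, Copp, RtoC; simpl. apply injective_projections; simpl; ring. Qed.

Lemma Cexp_opp_mult w : (Cexp w * Cexp (- w) = 1)%C.
Proof. rewrite <- Cexp_plus, Cplus_opp_r. apply Cexp_0. Qed.

Lemma Ccos2_Csin2 z : (Ccos z ^ 2 = 1 - Csin z ^ 2)%C.
Proof.
  unfold Ccos, Csin. generalize (Cexp_opp_mult (Ci * z)).
  set (p := Cexp (Ci * z)). set (q := Cexp (- (Ci * z))). intros H.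
  transitivity (p * q + (p - q) ^ 2 / (2 * 2))%C.
  - field.
  - rewrite H. transitivity (1 - (p - q) ^ 2 / (2 * 2 * (Ci * Ci)))%C.
    + rewrite Ci_sqr. field.
    + field. exact Ci_neq_0.
Qed.

Lemma Cexp_double w : Cexp (2 * w)%C = (Cexp w ^ 2)%C.
Proof. replace (2 * w)%C with (w + w)%C by ring. rewrite Cexp_plus. ring. Qed.

Lemma Csin_double z : Csin (2 * z)%C = (2 * Csin z * Ccos z)%C.
Proof.
  unfold Ccos, Csin.
  replace (Ci * (2 * z))%C with (2 * (Ci * z))%C by ring.
  replace (- (2 * (Ci * z)))%C with (2 * - (Ci * z))%C by ring.
  rewrite !Cexp_double. field. exact Ci_neq_0.
Qed.

Lemma Ccos_double z : Ccos (2 * z)%C = (1 - 2 * Csin z ^ 2)%C.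
Proof.
  transitivity (Ccos z ^ 2 - Csin z ^ 2)%C; [|rewrite Ccos2_Csin2; ring].
  transitivity (2 * Ccos z ^ 2 - 1)%C; [|rewrite Ccos2_Csin2; ring].
  unfold Ccos.
  replace (Ci * (2 * z))%C with (2 * (Ci * z))%C by ring.
  replace (- (2 * (Ci * z)))%C with (2 * - (Ci * z))%C by ring.
  rewrite !Cexp_double. generalize (Cexp_opp_mult (Ci * z)).
  set (p := Cexp (Ci * z)). set (q := Cexp (- (Ci * z))). intros H.
  transitivity ((p + q) ^ 2 / 2 - p * q)%C.
  - field.
  - rewrite H. field.
Qed.

Lemma Csin_parts (z : C) :
  Csin z = (sin (Re z) * cosh (Im z), cos (Re z) * sinh (Im z)).
Proof.
  destruct z as [x y]. unfold Csin. simpl.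
  transitivity ((sin x * cosh y, cos x * sinh y)%R * (2 * Ci) / (2 * Ci))%C.
  - f_equal. unfold Cexp, cosh, sinh, Cmult, Cminus, Cplus, Copp, Ci, RtoC; simpl.
    replace (0 * x - 1 * y) with (- y) by ring.
    replace (0 * y + 1 * x) with x by ring.
    rewrite Ropp_involutive, cos_neg, sin_neg.
    apply injective_projections; simpl; field.
  - field. exact Ci_neq_0.
Qed.

Lemma Ccos_RtoC (x : R) : Ccos (RtoC x) = RtoC (cos x).
Proof.
  unfold Ccos. transitivity (RtoC (cos x) * 2 / 2)%C.
  - f_equal. unfold Cexp, Cmult, Cplus, Copp, Ci, RtoC; simpl.
    replace (0 * x - 1 * 0) with 0 by ring. replace (0 * 0 + 1 * x) with x by ring.
    rewrite Ropp_0, exp_0, cos_neg, sin_neg.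
    apply injective_projections; simpl; ring.
  - field.
Qed.

Lemma Csin_RtoC (x : R) : Csin (RtoC x) = RtoC (sin x).
Proof.
  rewrite Csin_parts. simpl. rewrite cosh_0, sinh_0.
  unfold RtoC. f_equal; ring.
Qed.

Ltac eq_in_C := match goal with |- @eq _ ?x ?y => change (@eq C x y) end.

Notation is_Cderive := (@is_derive C_AbsRing C_NormedModule).

Lemma is_Cderive_scale (f : C -> C) (c z l : C) :
  is_Cderive f (c * z)%C l -> is_Cderive (fun k => f (c * k)%C) z (c * l)%C.
Proof.
  intros Hf.
  apply (is_derive_comp (K := C_AbsRing) (V := C_NormedModule) f (fun k => c * k)%C);
    [exact Hf|].
  apply (is_derive_ext (K := C_AbsRing) (V := AbsRing_NormedModule C_AbsRing)
           (fun k : C => scal k c)); [intros; apply Cmult_comm|].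
  apply (filterdiff_scal_l (K := C_AbsRing) (V := AbsRing_NormedModule C_AbsRing)).
Qed.

(** The complex numbers carry two normed-module structures, with different balls but
    the same norm; a derivative in one sense is a derivative in the other. *)
Lemma is_Cderive_AbsRing (f : C -> C) (z l : C) :
  is_Cderive f z l ->
  @is_derive C_AbsRing (AbsRing_NormedModule C_AbsRing) f z l.
Proof.
  intros [_ Hd]. split; [|exact Hd].
  apply (is_linear_scal_l (K := C_AbsRing) (V := AbsRing_NormedModule C_AbsRing)).
Qed.

Lemma is_Cderive_comb (f g : C -> C) (u v w z lf lg : C) :
  is_Cderive f z lf -> is_Cderive g z lg ->
  is_Cderive (fun k => w + u * f k + v * g k)%C z (u * lf + v * lg)%C.
Proof.
  intros Hf Hg.
  assert (Hscal : forall (h : C -> C) (a l : C), is_Cderive h z l ->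
            is_Cderive (fun k => a * h k)%C z (a * l)%C).
  { intros h a l Hh.
    apply (is_derive_ext (K := C_AbsRing) (V := C_NormedModule)
             (fun k : C => scal (h k) a)); [intros; apply Cmult_comm|].
    rewrite Cmult_comm.
    apply (is_derive_scal_l (K := C_AbsRing) (V := C_NormedModule)). now apply is_Cderive_AbsRing. }
  replace (u * lf + v * lg)%C with ((RtoC 0 + u * lf) + v * lg)%C by ring.
  apply (is_derive_plus (K := C_AbsRing) (V := C_NormedModule)); [|now apply Hscal].
  apply (is_derive_plus (K := C_AbsRing) (V := C_NormedModule)); [|now apply Hscal].
  apply (is_derive_const (K := C_AbsRing) (V := C_NormedModule)).
Qed.

Lemma is_Cderive_Cexp_Ci z :
  is_Cderive (fun w => Cexp (Ci * w))%C z (Ci * Cexp (Ci * z))%C /\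
  is_Cderive (fun w => Cexp (- (Ci * w)))%C z (- Ci * Cexp (- (Ci * z)))%C.
Proof.
  split.
  - apply is_Cderive_scale, is_derive_Cexp.
  - replace (- (Ci * z))%C with (- Ci * z)%C by ring.
    apply (is_derive_ext (K := C_AbsRing) (V := C_NormedModule) (fun w => Cexp (- Ci * w)%C)).
    + intros t. f_equal. ring.
    + apply is_Cderive_scale, is_derive_Cexp.
Qed.

Lemma is_Cderive_Csin z : is_Cderive Csin z (Ccos z).
Proof.
  destruct (is_Cderive_Cexp_Ci z) as [H1 H2].
  generalize (is_Cderive_comb _ _ (/ (2 * Ci)) (- / (2 * Ci)) 0 z _ _ H1 H2)%C.
  intros H. replace (Ccos z) with
    (/ (2 * Ci) * (Ci * Cexp (Ci * z)) + - / (2 * Ci) * (- Ci * Cexp (- (Ci * z))))%C.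
  - revert H. apply (is_derive_ext (K := C_AbsRing) (V := C_NormedModule)).
    intros t. unfold Csin. unfold Cdiv. eq_in_C. ring.
  - unfold Ccos. field. exact Ci_neq_0.
Qed.

Lemma is_Cderive_Ccos z : is_Cderive Ccos z (- Csin z)%C.
Proof.
  destruct (is_Cderive_Cexp_Ci z) as [H1 H2].
  generalize (is_Cderive_comb _ _ (/ 2) (/ 2) 0 z _ _ H1 H2)%C.
  intros H. replace (- Csin z)%C with
    (/ 2 * (Ci * Cexp (Ci * z)) + / 2 * (- Ci * Cexp (- (Ci * z))))%C.
  - revert H. apply (is_derive_ext (K := C_AbsRing) (V := C_NormedModule)).
    intros t. unfold Ccos. unfold Cdiv. eq_in_C. ring.
  - unfold Csin. transitivity (- ((Cexp (Ci * z) - Cexp (- (Ci * z))) * - (Ci * Ci) / (2 * Ci)))%C.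
    + field. exact Ci_neq_0.
    + rewrite Ci_sqr. f_equal. f_equal. ring.
Qed.

Lemma C_derive_sin_comb (a b u v : C) :
  C_derive (fun k => u * Csin (a * k) + v * Csin (b * k))%C
  = (fun k => 0 + (u * a) * Ccos (a * k) + (v * b) * Ccos (b * k))%C.
Proof.
  apply functional_extensionality. intros z. apply is_C_derive_unique.
  replace (0 + (u * a) * Ccos (a * z) + (v * b) * Ccos (b * z))%C
    with (u * (a * Ccos (a * z)) + v * (b * Ccos (b * z)))%C by ring.
  apply (is_derive_ext (K := C_AbsRing) (V := C_NormedModule)
           (fun k => 0 + u * Csin (a * k) + v * Csin (b * k))%C).
  - intros t. eq_in_C. ring.
  - apply is_Cderive_comb; apply is_Cderive_scale, is_Cderive_Csin.
Qed.

Lemma C_derive_cos_comb (a b u v w : C) :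
  C_derive (fun k => w + u * Ccos (a * k) + v * Ccos (b * k))%C
  = (fun k => - (u * a) * Csin (a * k) + - (v * b) * Csin (b * k))%C.
Proof.
  apply functional_extensionality. intros z. apply is_C_derive_unique.
  replace (- (u * a) * Csin (a * z) + - (v * b) * Csin (b * z))%C
    with (u * (a * - Csin (a * z)) + v * (b * - Csin (b * z)))%C by ring.
  apply is_Cderive_comb; apply is_Cderive_scale, is_Cderive_Ccos.
Qed.

Lemma Cmult_eq_0 (z w : C) : (z * w)%C = 0 -> z = 0 \/ w = 0.
Proof.
  intros H. destruct (Ceq_dec z 0) as [Hz | Hz]; [now left|].
  destruct (Ceq_dec w 0) as [Hw | Hw]; [now right|].
  exfalso. revert H. now apply Cmult_neq_0.
Qed.

(** * The transmission function *)

Section Transmission.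

Variables (sigma L : R).
Hypothesis HL : 0 < L.
Hypothesis Hsigma : 0 < sigma.
Hypothesis Hsigma1 : sigma <> 1.

Let p := sigma - 1.
Let q := sigma + 1.
Let b := Rabs (p / q).
Let F := transmission_fun sigma L.

Lemma abs_ratio_bounds : 0 < b < 1.
Proof.
  unfold b, p, q. split.
  - apply Rabs_pos_lt. apply Rmult_integral_contrapositive. split; [lra|].
    apply Rinv_neq_0_compat. lra.
  - apply Rabs_def1.
    + apply Rlt_div_l; lra.
    + apply (Rlt_div_r (-1)); lra.
Qed.

Lemma abs_ratio_sign : exists s, (s = 1 \/ s = -1) /\ p = s * b * q.
Proof.
  assert (Hq : 0 < q) by (unfold q; lra).
  unfold b. destruct (Rcase_abs (p / q)) as [H | H].
  - exists (-1). split; [now right|]. rewrite Rabs_left by assumption. field. lra.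
  - exists 1. split; [now left|]. rewrite Rabs_right by assumption. field. lra.
Qed.

Lemma transmission_fun_eq k :
  F k = (RtoC p ^ 2 * Csin (RtoC (q * (L / 2)) * k) ^ 2
         - RtoC q ^ 2 * Csin (RtoC (p * (L / 2)) * k) ^ 2)%C.
Proof.
  unfold F, transmission_fun, p, q.
  replace ((RtoC sigma + 1) * (k * L / 2))%C with (RtoC ((sigma + 1) * (L / 2)) * k)%C.
  - replace ((RtoC sigma - 1) * (k * L / 2))%C with (RtoC ((sigma - 1) * (L / 2)) * k)%C.
    + rewrite RtoC_minus, RtoC_plus. reflexivity.
    + rewrite RtoC_mult, RtoC_minus, RtoC_div by lra. field.
  - rewrite RtoC_mult, RtoC_plus, RtoC_div by lra. field.
Qed.

(** Doubling the angle turns the squares into a linear combination of two cosines,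
    whose iterated derivatives have a closed form. *)
Lemma transmission_fun_cos :
  F = (fun k => RtoC ((p ^ 2 - q ^ 2) / 2)
                + RtoC (- (p ^ 2) / 2) * Ccos (RtoC (q * L) * k)
                + RtoC (q ^ 2 / 2) * Ccos (RtoC (p * L) * k))%C.
Proof.
  apply functional_extensionality. intros k. rewrite transmission_fun_eq.
  assert (D : forall r, Ccos (RtoC (r * L) * k)%C
              = (1 - 2 * Csin (RtoC (r * (L / 2)) * k) ^ 2)%C).
  { intros r. rewrite <- Ccos_double. f_equal.
    rewrite Cmult_assoc, <- RtoC_mult. do 2 f_equal. field. }
  rewrite !D, !RtoC_div, RtoC_minus, RtoC_opp, !RtoC_pow by lra. field.
Qed.

Lemma transmission_derivatives :
  let a := RtoC (q * L) in let c := RtoC (p * L) in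
  let u := RtoC (- (p ^ 2) / 2) in let v := RtoC (q ^ 2 / 2) in
  let cos_comb u v := (fun k => 0 + u * Ccos (a * k) + v * Ccos (c * k))%C in
  let sin_comb u v := (fun k => u * Csin (a * k) + v * Csin (c * k))%C in
  C_derive_n F 1 = sin_comb (- (u * a))%C (- (v * c))%C /\
  C_derive_n F 2 = cos_comb (- (u * a) * a)%C (- (v * c) * c)%C /\
  C_derive_n F 3 = sin_comb (- (- (u * a) * a * a))%C (- (- (v * c) * c * c))%C /\
  C_derive_n F 4 = cos_comb (- (- (u * a) * a * a) * a)%C (- (- (v * c) * c * c) * c)%C.
Proof.
  intros a c u v cos_comb sin_comb.
  assert (E1 : C_derive_n F 1 = sin_comb (- (u * a))%C (- (v * c))%C).
  { cbn [C_derive_n]. rewrite transmission_fun_cos. apply C_derive_cos_comb. }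
  assert (E2 : C_derive_n F 2 = cos_comb (- (u * a) * a)%C (- (v * c) * c)%C).
  { change (C_derive_n F 2) with (C_derive (C_derive_n F 1)).
    rewrite E1. apply C_derive_sin_comb. }
  assert (E3 : C_derive_n F 3 = sin_comb (- (- (u * a) * a * a))%C (- (- (v * c) * c * c))%C).
  { change (C_derive_n F 3) with (C_derive (C_derive_n F 2)).
    rewrite E2. apply C_derive_cos_comb. }
  repeat split; auto.
  change (C_derive_n F 4) with (C_derive (C_derive_n F 3)).
  rewrite E3. apply C_derive_sin_comb.
Qed.

(** The substitution [z = half_scale * k] makes [PI] the width of a strip. *)
Definition half_scale : R := q * (L / 2).

Lemma half_scale_pos : 0 < half_scale.
Proof. unfold half_scale, q. apply Rmult_lt_0_compat; lra. Qed.

(** The function is [q ^ 2 * (b * S - S') * (b * S + S')] with [S = sin z] and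
    [S' = sin (b * z)], also when [p / q] is [- b], as [S'] enters through its square. *)
Lemma wavenumber_iff_root k :
  transmission_wavenumber sigma L k <->
  scaled_sine_root b (half_scale * Re k) (half_scale * Im k).
Proof.
  unfold transmission_wavenumber. fold F. rewrite transmission_fun_eq.
  assert (Hq : 0 < q) by (unfold q; lra).
  destruct abs_ratio_sign as [s [Hs Hp]].
  fold half_scale. set (x := half_scale * Re k). set (y := half_scale * Im k).
  assert (Hparts : forall r, Csin (RtoC r * k)%C =
            (sin (r * Re k) * cosh (r * Im k), cos (r * Re k) * sinh (r * Im k))).
  { intros r. rewrite Csin_parts. destruct k as [k1 k2]. unfold Re, Im; simpl.
    replace (r * k1 - 0 * k2) with (r * k1) by ring.
    replace (r * k2 + 0 * k1) with (r * k2) by ring. reflexivity. }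
  rewrite !Hparts. fold x y.
  assert (Hx : p * (L / 2) * Re k = s * (b * x)) by (unfold x, half_scale; rewrite Hp; ring).
  assert (Hy : p * (L / 2) * Im k = s * (b * y)) by (unfold y, half_scale; rewrite Hp; ring).
  rewrite Hx, Hy.
  assert (Hsz : (sin (s * (b * x)) * cosh (s * (b * y)), cos (s * (b * x)) * sinh (s * (b * y)))
              = (s * (sin (b * x) * cosh (b * y)), s * (cos (b * x) * sinh (b * y)))).
  { destruct Hs as [-> | ->]; [now rewrite !Rmult_1_l|].
    replace (-1 * (b * x)) with (- (b * x)) by ring.
    replace (-1 * (b * y)) with (- (b * y)) by ring.
    rewrite sin_neg, cos_neg, cosh_opp, sinh_opp. f_equal; ring. }
  rewrite Hsz.
  set (z1 := (sin x * cosh y, cos x * sinh y) : C).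
  set (z2 := (sin (b * x) * cosh (b * y), cos (b * x) * sinh (b * y)) : C).
  replace (s * (sin (b * x) * cosh (b * y)), s * (cos (b * x) * sinh (b * y)))
    with (RtoC s * z2)%C
    by (unfold z2, Cmult, RtoC; simpl; apply injective_projections; simpl; ring).
  assert (Hsc : (RtoC s ^ 2 = 1)%C).
  { rewrite <- RtoC_pow. f_equal. destruct Hs as [-> | ->]; ring. }
  assert (Hqc : RtoC q <> 0) by (intros E; apply RtoC_inj in E; lra).
  assert (Hfac : (RtoC p ^ 2 * z1 ^ 2 - RtoC q ^ 2 * (RtoC s * z2) ^ 2
          = RtoC q ^ 2 * ((RtoC b * z1 - z2) * (RtoC b * z1 + z2)))%C).
  { rewrite Hp, !RtoC_mult.
    transitivity (RtoC s ^ 2 * (RtoC q ^ 2 * ((RtoC b * z1) ^ 2 - z2 ^ 2)))%C; [ring|].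
    rewrite Hsc. ring. }
  rewrite Hfac. split.
  - intros H. apply Cmult_eq_0 in H. destruct H as [H | H].
    { exfalso. revert H. apply Cpow_nz, Hqc. }
    apply Cmult_eq_0 in H. destruct H as [H | H].
    + exists 1. split; [now left|].
      unfold z1, z2, Cmult, Cminus, Cplus, Copp, RtoC in H. simpl in H.
      injection H. intros H2 H1. split; lra.
    + exists (-1). split; [now right|].
      unfold z1, z2, Cmult, Cminus, Cplus, Copp, RtoC in H. simpl in H.
      injection H. intros H2 H1. split; lra.
  - intros [e [He [H1 H2]]].
    assert (E : (RtoC b * z1 = RtoC e * z2)%C).
    { unfold z1, z2, Cmult, RtoC; simpl. apply injective_projections; simpl; lra. }
    rewrite E. destruct He as [-> | ->].
    + ring.
    + replace (RtoC (-1)) with (- RtoC 1)%C by (rewrite <- RtoC_opp; f_equal; ring). ring.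
Qed.

(** At a multiple zero [p ^ 2 * S ^ 2 = q ^ 2 * S' ^ 2] and [p * S * C = q * S' * C'],
    where [S], [C], [S'], [C'] are the sines and cosines of [z] and [p / q * z].
    Squaring the second relation and eliminating [C], [C'] and [S'] leaves
    [p ^ 2 * (p ^ 2 - q ^ 2) * S ^ 4 = 0], so [sin z] would vanish. *)
Lemma wavenumber_simple k : sin (half_scale * Re k) <> 0 ->
  transmission_wavenumber sigma L k -> transmission_wavenumber_mult sigma L 1 k.
Proof.
  intros Hsin Hk. split; [lia|]. split.
  { intros i Hi. replace i with 0%nat by lia. exact Hk. }
  fold F. destruct transmission_derivatives as [-> _]. intros H0.
  unfold transmission_wavenumber in Hk. fold F in Hk. rewrite transmission_fun_eq in Hk.
  set (z := (RtoC (q * (L / 2)) * k)%C) in *.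
  set (z' := (RtoC (p * (L / 2)) * k)%C) in *.
  replace (RtoC (q * L) * k)%C with (2 * z)%C in H0
    by (unfold z; rewrite Cmult_assoc, <- RtoC_mult; do 2 f_equal; field).
  replace (RtoC (p * L) * k)%C with (2 * z')%C in H0
    by (unfold z'; rewrite Cmult_assoc, <- RtoC_mult; do 2 f_equal; field).
  rewrite !Csin_double in H0.
  assert (Hp0 : RtoC p <> 0) by (intros E; apply RtoC_inj in E; unfold p in E; lra).
  assert (Hq0 : RtoC q <> 0) by (intros E; apply RtoC_inj in E; unfold q in E; lra).
  assert (HL0 : RtoC L <> 0) by (intros E; apply RtoC_inj in E; lra).
  assert (H1 : (RtoC p * Csin z * Ccos z = RtoC q * Csin z' * Ccos z')%C).
  { assert (E : (RtoC p * RtoC q * RtoC L *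
        (RtoC p * Csin z * Ccos z - RtoC q * Csin z' * Ccos z') = 0)%C).
    { rewrite <- H0. rewrite !RtoC_div, !RtoC_mult, RtoC_opp, !RtoC_pow by lra. field. }
    apply Cmult_eq_0 in E. destruct E as [E | E].
    - exfalso. revert E. repeat apply Cmult_neq_0; assumption.
    - transitivity (RtoC p * Csin z * Ccos z - RtoC q * Csin z' * Ccos z'
                    + RtoC q * Csin z' * Ccos z')%C; [ring | rewrite E; ring]. }
  assert (Hk' : (RtoC q ^ 2 * Csin z' ^ 2 = RtoC p ^ 2 * Csin z ^ 2)%C).
  { transitivity (RtoC p ^ 2 * Csin z ^ 2 -
      (RtoC p ^ 2 * Csin z ^ 2 - RtoC q ^ 2 * Csin z' ^ 2))%C; [ring | rewrite Hk; ring]. }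
  assert (HS : (RtoC (p ^ 2 * (p ^ 2 - q ^ 2)) * Csin z ^ 4 = 0)%C).
  { rewrite RtoC_mult, RtoC_minus, !RtoC_pow.
    assert (E : ((RtoC p * Csin z * Ccos z) ^ 2 = (RtoC q * Csin z' * Ccos z') ^ 2)%C)
      by now rewrite H1.
    assert (E2 : (RtoC p ^ 2 * Csin z ^ 2 * Ccos z ^ 2 = RtoC q ^ 2 * Csin z' ^ 2 * Ccos z' ^ 2)%C).
    { transitivity ((RtoC p * Csin z * Ccos z) ^ 2)%C; [ring|]. rewrite E. ring. }
    rewrite Hk', !Ccos2_Csin2 in E2.
    transitivity (RtoC q ^ 2 * (RtoC p ^ 2 * Csin z ^ 2 * (1 - Csin z ^ 2))
       - RtoC p ^ 2 * Csin z ^ 2 * (RtoC q ^ 2 - RtoC p ^ 2 * Csin z ^ 2))%C; [ring|].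
    rewrite E2, <- Hk'. ring. }
  apply Cmult_eq_0 in HS. destruct HS as [HS | HS].
  - apply RtoC_inj in HS. exfalso.
    apply Rmult_integral in HS. destruct HS as [HS | HS].
    + revert HS. apply pow_nonzero. unfold p. lra.
    + unfold p, q in HS. lra.
  - assert (HS0 : Csin z = 0).
    { destruct (Ceq_dec (Csin z) 0) as [E | E]; [exact E|].
      exfalso. revert HS. now apply Cpow_nz. }
    rewrite Csin_parts in HS0. apply (f_equal fst) in HS0.
    change (sin (Re z) * cosh (Im z) = 0) in HS0. rename HS0 into Hre.
    apply Rmult_integral in Hre. destruct Hre as [Hre | Hre].
    + apply Hsin. rewrite <- Hre. f_equal. unfold z, half_scale.
      destruct k; simpl. fold q. ring.
    + generalize (cosh_pos (Im z)). rewrite Hre. lra.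
Qed.

(** At such a point both sines vanish and both cosines equal [1]. The odd derivatives
    vanish with the sines; the second one vanishes because [p * (q * L) = q * (p * L)],
    and the fourth is then proportional to [p ^ 2 - q ^ 2 = - 4 * sigma]. *)
Lemma wavenumber_quadruple j n : p / q * IZR j = IZR n ->
  transmission_wavenumber_mult sigma L 4 (RtoC (2 * IZR j * PI / (q * L))).
Proof.
  intros Hn. set (k := RtoC (2 * IZR j * PI / (q * L))).
  assert (Hp0 : p <> 0) by (unfold p; lra).
  assert (Hq0 : q <> 0) by (unfold q; lra).
  assert (Ha : (RtoC (q * L) * k)%C = RtoC (2 * (IZR j * PI))).
  { unfold k. rewrite <- RtoC_mult. f_equal. field. split; lra. }
  assert (Hc : (RtoC (p * L) * k)%C = RtoC (2 * (IZR n * PI))).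
  { unfold k. rewrite <- RtoC_mult, <- Hn. f_equal. field. split; lra. }
  assert (Hper : forall i : Z, Csin (RtoC (2 * (IZR i * PI))) = 0 /\
                               Ccos (RtoC (2 * (IZR i * PI))) = 1).
  { intros i. rewrite Csin_RtoC, Ccos_RtoC, sin_2a, cos_2a_sin, sin_IZR_PI.
    split; f_equal; ring. }
  destruct (Hper j) as [Sj Cj]. destruct (Hper n) as [Sn Cn].
  destruct transmission_derivatives as [E1 [E2 [E3 E4]]].
  split; [lia|]. fold F. split.
  - intros i Hi. destruct i as [|[|[|[|i]]]]; [| | | | lia].
    + cbn [C_derive_n]. rewrite transmission_fun_cos, Ha, Hc, Cj, Cn.
      rewrite !RtoC_div, RtoC_minus, RtoC_opp by lra. field.
    + rewrite E1, Ha, Hc, Sj, Sn. ring.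
    + rewrite E2, Ha, Hc, Cj, Cn.
      rewrite !RtoC_div, !RtoC_mult, RtoC_opp, !RtoC_pow by lra. field.
    + rewrite E3, Ha, Hc, Sj, Sn. ring.
  - rewrite E4, Ha, Hc, Cj, Cn.
    replace (0 + - (- (RtoC (- p ^ 2 / 2) * RtoC (q * L)) * RtoC (q * L) * RtoC (q * L)) *
       RtoC (q * L) * 1 + - (- (RtoC (q ^ 2 / 2) * RtoC (p * L)) * RtoC (p * L) *
       RtoC (p * L)) * RtoC (p * L) * 1)%C
      with (RtoC (p ^ 2 * q ^ 2 * L ^ 4 * (p ^ 2 - q ^ 2) / 2)).
    + intros E. apply RtoC_inj in E.
      assert (Hpq : p ^ 2 - q ^ 2 = - (4 * sigma)) by (unfold p, q; ring).
      rewrite Hpq in E.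
      assert (0 < p ^ 2 * q ^ 2 * L ^ 4 * (4 * sigma)).
      { assert (0 < p ^ 2) by (generalize (pow_nonzero p 2 Hp0) (pow2_ge_0 p); lra).
        assert (0 < q ^ 2) by (generalize (pow_nonzero q 2 Hq0) (pow2_ge_0 q); lra).
        assert (0 < L ^ 4) by now apply pow_lt.
        assert (0 < p ^ 2 * q ^ 2) by now apply Rmult_lt_0_compat.
        assert (0 < p ^ 2 * q ^ 2 * L ^ 4) by now apply Rmult_lt_0_compat.
        apply Rmult_lt_0_compat; lra. }
      lra.
    + rewrite !RtoC_div, !RtoC_mult, RtoC_opp, RtoC_minus, !RtoC_pow by lra. field.
Qed.

Lemma strip_rescale_lt i r :
  2 * IZR i * PI / (q * L) < r <-> IZR i * PI < half_scale * r.
Proof.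
  assert (Hqc : 0 < q * L) by (unfold q; apply Rmult_lt_0_compat; lra).
  rewrite (Rlt_div_l (2 * IZR i * PI) r (q * L) Hqc). unfold half_scale. split; intros; lra.
Qed.

Lemma strip_rescale_gt i r :
  r < 2 * IZR i * PI / (q * L) <-> half_scale * r < IZR i * PI.
Proof.
  assert (Hqc : 0 < q * L) by (unfold q; apply Rmult_lt_0_compat; lra).
  rewrite <- (Rlt_div_r r (2 * IZR i * PI) (q * L) Hqc). unfold half_scale. split; intros; lra.
Qed.

End Transmission.

(** * Floors and integers between consecutive multiples *)

Lemma Zfloor_lt x : ~ is_integer x -> IZR (Zfloor x) < x.
Proof.
  intros Hx. destruct (Zfloor_bound x) as [[H | H] _]; [exact H|].
  exfalso. apply Hx. now exists (Zfloor x).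
Qed.

(** The ratio [a] is negative when [sigma < 1], while the count of roots depends on
    [Rabs a] only. Off the integers [Zfloor (- x) = - Zfloor x - 1], so whether two
    floors agree is insensitive to the sign; only the witness changes. *)
Lemma floor_neq_crossing a (j : Z) :
  ~ is_integer (a * IZR j) -> ~ is_integer (a * IZR (j + 1)) ->
  Zfloor (a * IZR j) <> Zfloor (a * IZR (j + 1)) ->
  exists n, Rabs a * IZR j < IZR n < Rabs a * IZR (j + 1).
Proof.
  intros H1 H2 Hf.
  generalize (Zfloor_lt _ H1) (Zfloor_lt _ H2). intros L1 L2.
  destruct (Zfloor_bound (a * IZR j)) as [_ U1].
  destruct (Zfloor_bound (a * IZR (j + 1))) as [_ U2].
  assert (Hj : IZR (j + 1) = IZR j + 1) by apply plus_IZR.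
  destruct (Rcase_abs a) as [Ha | Ha].
  - exists (- Zfloor (a * IZR j))%Z. rewrite Rabs_left, opp_IZR by assumption.
    assert (Zfloor (a * IZR (j + 1)) <= Zfloor (a * IZR j))%Z by (apply Zfloor_le; nra).
    assert (Zfloor (a * IZR (j + 1)) + 1 <= Zfloor (a * IZR j))%Z by lia.
    apply IZR_le in H0. rewrite plus_IZR in H0. lra.
  - exists (Zfloor (a * IZR (j + 1))). rewrite Rabs_right by assumption.
    assert (Zfloor (a * IZR j) <= Zfloor (a * IZR (j + 1)))%Z by (apply Zfloor_le; nra).
    assert (Zfloor (a * IZR j) + 1 <= Zfloor (a * IZR (j + 1)))%Z by lia.
    apply IZR_le in H0. rewrite plus_IZR in H0. lra.
Qed.

Lemma floor_eq_noncrossing a (j : Z) :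
  ~ is_integer (a * IZR j) -> ~ is_integer (a * IZR (j + 1)) ->
  Zfloor (a * IZR j) = Zfloor (a * IZR (j + 1)) ->
  exists n, IZR n < Rabs a * IZR j /\ Rabs a * IZR (j + 1) < IZR n + 1.
Proof.
  intros H1 H2 Hf.
  generalize (Zfloor_lt _ H1) (Zfloor_lt _ H2). intros L1 L2.
  destruct (Zfloor_bound (a * IZR j)) as [_ U1].
  destruct (Zfloor_bound (a * IZR (j + 1))) as [_ U2].
  rewrite <- Hf in *.
  destruct (Rcase_abs a) as [Ha | Ha].
  - exists (- Zfloor (a * IZR j) - 1)%Z. rewrite Rabs_left, minus_IZR, opp_IZR by assumption.
    lra.
  - exists (Zfloor (a * IZR j)). rewrite Rabs_right by assumption. lra.
Qed.

(** * Counting the wavenumbers *)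

Theorem theorem3 (L sigma m : R) (j : Z)
    (HL : 0 < L) (Hsigma : 0 < sigma) (Hsigma1 : sigma <> 1)
    (Hm : m = (sigma + 1) / (sigma - 1)) :
  (~ is_integer (IZR j / m) -> ~ is_integer (IZR (j + 1) / m) ->
   exists k1 k2 : C,
     k1 <> k2 /\
     (forall k : C,
        2 * IZR j * PI / ((sigma + 1) * L) < Re k
          < 2 * IZR (j + 1) * PI / ((sigma + 1) * L) ->
        (transmission_wavenumber sigma L k <-> k = k1 \/ k = k2)) /\
     2 * IZR j * PI / ((sigma + 1) * L) < Re k1
       < 2 * IZR (j + 1) * PI / ((sigma + 1) * L) /\
     2 * IZR j * PI / ((sigma + 1) * L) < Re k2
       < 2 * IZR (j + 1) * PI / ((sigma + 1) * L) /\
     transmission_wavenumber_mult sigma L 1 k1 /\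
     transmission_wavenumber_mult sigma L 1 k2 /\
     (Zfloor (IZR j / m) <> Zfloor (IZR (j + 1) / m) ->
      Im k1 = 0 /\ Im k2 = 0) /\
     (Zfloor (IZR j / m) = Zfloor (IZR (j + 1) / m) ->
      k2 = Cconj k1 /\ Im k1 <> 0 /\ Im k2 <> 0))
  /\
  (is_integer (IZR j / m) ->
   transmission_wavenumber_mult sigma L 4
     (RtoC (2 * IZR j * PI / ((sigma + 1) * L))) /\
   (forall k : C,
      2 * IZR (j - 1) * PI / ((sigma + 1) * L) < Re k
        < 2 * IZR (j + 1) * PI / ((sigma + 1) * L) ->
      transmission_wavenumber sigma L k ->
      k = RtoC (2 * IZR j * PI / ((sigma + 1) * L)))).
Proof.
  set (a := (sigma - 1) / (sigma + 1)).
  assert (Ea : forall i : Z, IZR i / m = a * IZR i)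
    by (intros i; unfold a; rewrite Hm; field; lra).
  rewrite !Ea. clear Ea.
  set (kap := half_scale sigma L).
  assert (Hkap : 0 < kap) by now apply half_scale_pos.
  assert (Hb : 0 < Rabs a < 1) by now apply abs_ratio_bounds.
  assert (Hstrip : forall i i' r,
    2 * IZR i * PI / ((sigma + 1) * L) < r < 2 * IZR i' * PI / ((sigma + 1) * L) <->
    IZR i * PI < kap * r < IZR i' * PI).
  { intros i i' r. rewrite (strip_rescale_lt sigma L HL Hsigma i r),
      (strip_rescale_gt sigma L HL Hsigma i' r). reflexivity. }
  assert (Hroot : forall k, transmission_wavenumber sigma L k <->
            scaled_sine_root (Rabs a) (kap * Re k) (kap * Im k))
    by (intros k; now apply wavenumber_iff_root).
  assert (Hkx : forall x, kap * (x / kap) = x) by (intros; field; lra).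
  assert (Hdiv : forall r x, kap * r = x <-> r = x / kap).
  { intros r x. split; [intros <-; field; lra | intros ->; apply Hkx]. }
  assert (Hext : forall k x y, kap * Re k = x -> kap * Im k = y -> k = (x / kap, y / kap)).
  { intros [k1 k2] x y H1 H2. simpl in H1, H2. apply Hdiv in H1, H2. now f_equal. }
  assert (Hsimple : forall k, IZR j * PI < kap * Re k < IZR (j + 1) * PI ->
            transmission_wavenumber sigma L k -> transmission_wavenumber_mult sigma L 1 k).
  { intros k Hk. apply wavenumber_simple; auto. now apply (sin_strip_neq_0 j). }
  split.
  - intros Hj Hj1.
    destruct (Z.eq_dec (Zfloor (a * IZR j)) (Zfloor (a * IZR (j + 1)))) as [Hf | Hf].
    + destruct (floor_eq_noncrossing a j Hj Hj1 Hf) as [n [Hn1 Hn2]].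
      destruct (strip_roots_conjugate (Rabs a) j Hb n Hn1 Hn2)
        as [x0 [y0 [Hy0 [Hx0 Hr]]]].
      assert (Hy : 0 < y0 / kap) by now apply Rdiv_lt_0_compat.
      exists (x0 / kap, y0 / kap), (x0 / kap, - y0 / kap).
      assert (H1 : IZR j * PI < kap * (x0 / kap) < IZR (j + 1) * PI) by now rewrite Hkx.
      split.
      { intros E. apply (f_equal snd) in E. simpl in E. unfold Rdiv in *. lra. }
      split.
      { intros k Hk. apply Hstrip in Hk. rewrite Hroot, (Hr _ _ Hk). split.
        - intros [Ex [Ey | Ey]]; [left | right]; now apply Hext.
        - intros [-> | ->]; simpl; rewrite !Hkx; auto. }
      split; [now apply Hstrip|]. split; [now apply Hstrip|].
      split; [apply Hsimple; [exact H1|]; apply Hroot, Hr; simpl; rewrite !Hkx; auto|].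
      split; [apply Hsimple; [exact H1|]; apply Hroot, Hr; simpl; rewrite !Hkx; auto|].
      split; [contradiction|]. intros _. split; [|simpl; split; unfold Rdiv in *; lra].
      unfold Cconj; simpl. f_equal. unfold Rdiv. ring.
    + destruct (floor_neq_crossing a j Hj Hj1 Hf) as [n Hn].
      destruct (strip_roots_real (Rabs a) j Hb n Hn)
        as [x1 [x2 [Hne [Hx1 [Hx2 Hr]]]]].
      exists (x1 / kap, 0 / kap), (x2 / kap, 0 / kap).
      assert (H1 : IZR j * PI < kap * (x1 / kap) < IZR (j + 1) * PI) by now rewrite Hkx.
      assert (H2 : IZR j * PI < kap * (x2 / kap) < IZR (j + 1) * PI) by now rewrite Hkx.
      split.
      { intros E. apply (f_equal fst) in E. simpl in E. apply Hne.
        rewrite <- (Hkx x1), <- (Hkx x2), E. reflexivity. }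
      split.
      { intros k Hk. apply Hstrip in Hk. rewrite Hroot, (Hr _ _ Hk). split.
        - intros [Ey [Ex | Ex]]; [left | right]; now apply Hext.
        - intros [-> | ->]; simpl; rewrite !Hkx; auto. }
      split; [now apply Hstrip|]. split; [now apply Hstrip|].
      split; [apply Hsimple; [exact H1|]; apply Hroot, Hr; simpl; rewrite !Hkx; auto|].
      split; [apply Hsimple; [exact H2|]; apply Hroot, Hr; simpl; rewrite !Hkx; auto|].
      split; [|contradiction]. intros _. simpl. unfold Rdiv. split; ring.
  - intros [n Hn]. split.
    + now apply (wavenumber_quadruple sigma L HL Hsigma Hsigma1 j n).
    + intros k Hk Hw. apply Hstrip in Hk. apply Hroot in Hw.
      assert (Hn' : exists n', Rabs a * IZR j = IZR n').
      { destruct (Rcase_abs a) as [H | H].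
        - exists (- n)%Z. rewrite Rabs_left, opp_IZR by assumption. lra.
        - exists n. now rewrite Rabs_right. }
      destruct Hn' as [n' Hn'].
      destruct (double_strip_root_at_node (Rabs a) j n' _ _ Hb Hn' Hk Hw) as [Hx Hy].
      rewrite (Hext k _ _ Hx Hy). unfold RtoC, kap, half_scale.
      f_equal; field; split; lra.
Qed.
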